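(* Let $G \subset \mathrm{Diff}^1_+(\mathbb{S}^2)$ be a group containing the rotation group $\mathrm{Rot}(\mathbb{S}^2)=SO(3)$. If $G$ is sharply $3$-transitive, then $G=\mathrm{M\ddot{o}b}(\mathbb{S}^2)$.
   Context: $\mathrm{Diff}^1_+(\mathbb{S}^2)$ denotes the group of orientation-preserving $C^1$ diffeomorphisms of the unit sphere $\mathbb{S}^2\subset\mathbb{R}^3$; $\mathrm{Rot}(\mathbb{S}^2)$ is the group of rotations of $\mathbb{R}^3$ restricted to $\mathbb{S}^2$. $\mathbb{S}^2$ is identified with $\mathbb{C}\cup\{\infty\}$ by stereographic projection; $\mathrm{M\ddot{o}b}(\mathbb{S}^2)$ is the group of maps $z\mapsto (az+b)/(cz+d)$, $ad-bc=1$. A group $G$ of homeomorphisms is $3$-transitive if for any two triples of mutually distinct points $(p_1,p_2,p_3)$, $(q_1,q_2,q_3)$ there is $g\in G$ with $g(p_i)=q_i$; it is sharply $3$-transitive if moreover the only element of $G$ fixing every point of a triple of distinct points is the identity. *)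

(* Defs.v *)
From mathcomp Require Import all_boot all_order all_algebra.
From mathcomp Require Import all_classical all_reals all_analysis.
From mathcomp Require Import complex.
Import GRing.Theory Num.Theory numFieldNormedType.Exports.
Local Open Scope classical_set_scope.
Local Open Scope ring_scope.

Set Implicit Arguments.
Unset Strict Implicit.
Unset Printing Implicit Defensive.

Section Sphere.
Variable R : realType.

Definition i1 : 'I_3 := @Ordinal 3 0 isT.
Definition i2 : 'I_3 := @Ordinal 3 1 isT.
Definition i3 : 'I_3 := @Ordinal 3 2 isT.
Definition j1 : 'I_2 := @Ordinal 2 0 isT.
Definition j2 : 'I_2 := @Ordinal 2 1 isT.

Definition vec3 (a b c : R) : 'rV[R]_3 := \row_(k < 3) [:: a; b; c]`_k.
Definition vec2 (a b : R) : 'rV[R]_2 := \row_(k < 2) [:: a; b]`_k.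

Definition on_sphere (x : 'rV[R]_3) : bool := \sum_(k < 3) x ord0 k ^+ 2 == 1.
Definition S2 := {x : 'rV[R]_3 | on_sphere x}.

Definition north_v : 'rV[R]_3 := vec3 0 0 1.
Definition south_v : 'rV[R]_3 := vec3 0 0 (-1).
Lemma north_on : on_sphere north_v.
Proof.
rewrite /on_sphere !big_ord_recr big_ord0 /= /north_v /vec3 !mxE /=.
by rewrite expr0n /= !add0r expr1n.
Qed.
Definition north : S2 := exist _ north_v north_on.

(* total map R^3 -> S^2 (only ever applied to points of the sphere) *)
Definition to_S2 (x : 'rV[R]_3) : S2 := insubd north x.

Definition south : S2 := to_S2 south_v.

(* The oriented stereographic atlas: chart [true] is the stereographic
   projection from the north pole, chart [false] the (conjugated)
   stereographic projection from the south pole; the transition map is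
   z |-> 1/z, so the atlas is oriented. *)
Definition pole (b : bool) : S2 := if b then north else south.

Definition chart (b : bool) (p : S2) : 'rV[R]_2 :=
  let x := val p in
  if b then vec2 (x ord0 i1 / (1 - x ord0 i3)) (x ord0 i2 / (1 - x ord0 i3))
  else vec2 (x ord0 i1 / (1 + x ord0 i3)) (- x ord0 i2 / (1 + x ord0 i3)).

Definition chart_inv (b : bool) (u : 'rV[R]_2) : S2 :=
  let s := u ord0 j1 in let t := u ord0 j2 in
  let r := s ^+ 2 + t ^+ 2 in
  if b then to_S2 (vec3 (2 * s / (r + 1)) (2 * t / (r + 1)) ((r - 1) / (r + 1)))
  else to_S2 (vec3 (2 * s / (1 + r)) (- (2 * t) / (1 + r)) ((1 - r) / (1 + r))).

Definition e2 (j : 'I_2) : 'rV[R]_2 := delta_mx ord0 j.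

Definition C1_on (U : set 'rV[R]_2) (g : 'rV[R]_2 -> 'rV[R]_2) : Prop :=
  open U /\
  forall j : 'I_2,
    (forall u, U u -> derivable g u (e2 j)) /\
    (forall u, U u -> {for u, continuous (fun w => 'D_(e2 j) g w)}).

Definition jacobian (g : 'rV[R]_2 -> 'rV[R]_2) (u : 'rV[R]_2) : 'M[R]_2 :=
  \matrix_(i < 2, j < 2) ('D_(e2 j) g u) ord0 i.

Definition chart_dom (f : S2 -> S2) (i j : bool) : set 'rV[R]_2 :=
  [set u | f (chart_inv i u) <> pole j].
Definition chart_expr (f : S2 -> S2) (i j : bool) (u : 'rV[R]_2) : 'rV[R]_2 :=
  chart j (f (chart_inv i u)).

(* f is C^1: all local expressions are C^1 on their (open) domains
   (openness of the domains amounts to continuity of f) *)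
Definition C1_S2 (f : S2 -> S2) : Prop :=
  forall i j : bool, C1_on (chart_dom f i j) (chart_expr f i j).

Definition orient_pres (f : S2 -> S2) : Prop :=
  forall (i j : bool) u, chart_dom f i j u -> 0 < \det (jacobian (chart_expr f i j) u).

Definition Diff1plus : set (S2 -> S2) :=
  [set f | C1_S2 f /\ orient_pres f /\
           exists g : S2 -> S2, C1_S2 g /\ cancel f g /\ cancel g f].

Definition rot_map (M : 'M[R]_3) (p : S2) : S2 := to_S2 (val p *m M).
Definition Rot : set (S2 -> S2) :=
  [set f | exists M : 'M[R]_3, M *m M^T = 1%:M /\ \det M = 1 /\ f = rot_map M].

(* Mobius group, via the stereographic identification S^2 = C u {oo}
   (north pole <-> oo, z = (x1 + i x2)/(1 - x3)) *)
Definition stereoC (p : S2) : R[i] :=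
  let u := chart true p in Complex (u ord0 j1) (u ord0 j2).
Definition stereoC_inv (z : R[i]) : S2 := let: Complex s t := z in chart_inv true (vec2 s t).

Definition mob_map (a b c d : R[i]) (p : S2) : S2 :=
  if p == north then (if c == 0 then north else stereoC_inv (a / c))
  else let z := stereoC p in
       if c * z + d == 0 then north else stereoC_inv ((a * z + b) / (c * z + d)).

Definition Mob : set (S2 -> S2) :=
  [set f | exists a b c d : R[i], a * d - b * c = 1 /\ f = mob_map a b c d].

Definition is_group (G : set (S2 -> S2)) : Prop :=
  G id /\ (forall f g, G f -> G g -> G (f \o g)) /\
  (forall f, G f -> exists2 g, G g & cancel f g /\ cancel g f).

Definition three_transitive (G : set (S2 -> S2)) : Prop :=
  forall p1 p2 p3 q1 q2 q3 : S2,
    [/\ p1 <> p2, p1 <> p3 & p2 <> p3] -> [/\ q1 <> q2, q1 <> q3 & q2 <> q3] ->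
    exists2 g, G g & [/\ g p1 = q1, g p2 = q2 & g p3 = q3].

Definition sharply_three_transitive (G : set (S2 -> S2)) : Prop :=
  three_transitive G /\
  forall g, G g -> forall p1 p2 p3 : S2,
    [/\ p1 <> p2, p1 <> p3 & p2 <> p3] ->
    [/\ g p1 = p1, g p2 = p2 & g p3 = p3] -> g = id.

End Sphere.

(* Main.v *)
Require Import Defs.
From mathcomp Require Import all_boot all_order all_algebra.
From mathcomp Require Import all_classical all_reals all_analysis.
From mathcomp Require Import complex ring lra.
Import Order.TTheory GRing.Theory Num.Theory numFieldNormedType.Exports.
Local Open Scope classical_set_scope.
Local Open Scope ring_scope.
Local Open Scope complex_scope.

(** Let [H] be the stabilizer of [0] and [oo] in [G].

    Elements of [H] commute with the rotations [z |-> e z], [|e| = 1]: for [f] in [H]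
    and any angle [d], the continuous periodic function [t |-> |f(e^(i t))|] takes the
    same value at [t] and [t + d] for some [t], so [f R_d f^-1] agrees with a rotation
    [R_d'] at [0], [oo] and [f(e^(i t))]; by sharpness they are equal, and comparing
    differentials at [0], where [det Df > 0], gives [d' = d].  In particular [f] is
    conformal at [0].

    Any [g] in [G] fixing [0] is then conformal at [0]: if [g] moves [oo] to [x], let
    [j] in [G] fix [0] and exchange [x] and [oo].  By sharpness [j^2 = id], so
    [Dj(0) = 1] or [-1], while [j g] lies in [H].  Conjugating by rotations, every
    element of [G] is conformal everywhere.

    For [f] in [H], conformality and [f(e^(i t) z) = e^(i t) f(z)] give [r f'(r) = f(r)]
    on the positive axis, so [f] is [z |-> c z].  Hence [G] contains all dilations; with
    the rotations they generate the Moebius group, and conversely an element of [G]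
    composed with a suitable Moebius map falls into [H]. *)

Set Implicit Arguments.
Unset Strict Implicit.
Unset Printing Implicit Defensive.

(** * Stereographic charts and Moebius maps *)

Section Geometry.
Variable R : realType.
Implicit Types (p q : S2 R) (u : 'rV[R]_2) (x y : R) (z w : R[i]).

Lemma vec3P (v w : 'rV[R]_3) : v ord0 i1 = w ord0 i1 -> v ord0 i2 = w ord0 i2 ->
  v ord0 i3 = w ord0 i3 -> v = w.
Proof.
move=> e1 e2 e3; apply/rowP => -[[|[|[|//]]] lt_i].
- by rewrite (_ : Ordinal lt_i = i1) //; apply: val_inj.
- by rewrite (_ : Ordinal lt_i = i2) //; apply: val_inj.
- by rewrite (_ : Ordinal lt_i = i3) //; apply: val_inj.
Qed.

Lemma vec2P (v w : 'rV[R]_2) : v ord0 j1 = w ord0 j1 -> v ord0 j2 = w ord0 j2 ->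
  v = w.
Proof.
move=> e1 e2; apply/rowP => -[[|[|//]] lt_i].
- by rewrite (_ : Ordinal lt_i = j1) //; apply: val_inj.
- by rewrite (_ : Ordinal lt_i = j2) //; apply: val_inj.
Qed.

Lemma vec2E x y : (vec2 x y ord0 j1 = x) * (vec2 x y ord0 j2 = y).
Proof. by rewrite !mxE. Qed.

Lemma vec3E x y (c : R) : (vec3 x y c ord0 i1 = x) * (vec3 x y c ord0 i2 = y) *
  (vec3 x y c ord0 i3 = c).
Proof. by rewrite !mxE. Qed.

Lemma vec2_eta u : u = vec2 (u ord0 j1) (u ord0 j2).
Proof. by apply: vec2P; rewrite !vec2E. Qed.

Lemma sum3 (F : 'I_3 -> R) : \sum_k F k = F i1 + F i2 + F i3.
Proof.
rewrite !big_ord_recr big_ord0 /= add0r.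
by congr (F _ + F _ + F _); apply: val_inj.
Qed.

Lemma on_sphereE (v : 'rV[R]_3) :
  on_sphere v = (v ord0 i1 ^+ 2 + v ord0 i2 ^+ 2 + v ord0 i3 ^+ 2 == 1).
Proof. by rewrite /on_sphere sum3. Qed.

Lemma sphereP p : val p ord0 i1 ^+ 2 + val p ord0 i2 ^+ 2 + val p ord0 i3 ^+ 2 = 1.
Proof. by apply/eqP; rewrite -on_sphereE; exact: valP. Qed.

Lemma val_to_S2 (v : 'rV[R]_3) : on_sphere v -> val (to_S2 v) = v.
Proof. by move=> hv; rewrite /to_S2 val_insubd hv. Qed.

Lemma sumsq_gt0 x y : 0 < x ^+ 2 + y ^+ 2 + 1.
Proof. by rewrite ltr_wpDl // addr_ge0 // sqr_ge0. Qed.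

Lemma val_chart_inv u : let r := u ord0 j1 ^+ 2 + u ord0 j2 ^+ 2 in
  val (chart_inv true u) =
    vec3 (2 * u ord0 j1 / (r + 1)) (2 * u ord0 j2 / (r + 1)) ((r - 1) / (r + 1)).
Proof.
move=> r; rewrite /chart_inv val_to_S2 // on_sphereE !vec3E; apply/eqP.
by rewrite /r; field; rewrite gt_eqF // sumsq_gt0.
Qed.

Lemma chart_inv_neq_north u : chart_inv true u <> north R.
Proof.
move=> /(congr1 val); rewrite val_chart_inv.
move=> /(congr1 (fun v : 'rV[R]_3 => v ord0 i3)); rewrite /= /north_v !vec3E => /eqP.
have r0 := sumsq_gt0 (u ord0 j1) (u ord0 j2).
by rewrite -[X in _ == X]divr1 eqr_div ?oner_eq0 ?lt0r_neq0 // !mulr1 mul1r => /eqP; lra.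
Qed.

Lemma chart_invK : cancel (chart_inv true) (@chart R true).
Proof.
move=> u; rewrite /chart val_chart_inv /=.
have r0 := lt0r_neq0 (sumsq_gt0 (u ord0 j1) (u ord0 j2)).
by apply: vec2P; rewrite !vec3E !vec2E; field; rewrite r0 /=;
  apply/eqP; lra.
Qed.

Lemma north_i3 p : val p ord0 i3 = 1 -> p = north R.
Proof.
move=> p3; have := sphereP p; rewrite p3 expr1n.
have := sqr_ge0 (val p ord0 i1); have := sqr_ge0 (val p ord0 i2) => h1 h2 h.
have /eqP : val p ord0 i1 ^+ 2 = 0 by lra.
have /eqP : val p ord0 i2 ^+ 2 = 0 by lra.
rewrite !sqrf_eq0 => /eqP e2 /eqP e1.
by apply: val_inj; apply: vec3P; rewrite /= /north_v !vec3E.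
Qed.

Lemma chartK p : p <> north R -> chart_inv true (chart true p) = p.
Proof.
move=> pN; have p3 : 1 - val p ord0 i3 != 0.
  by apply/eqP => e; apply: pN; apply: north_i3; lra.
have sp := sphereP p; apply: val_inj; rewrite val_chart_inv /chart !vec2E.
have e : (val p ord0 i1 / (1 - val p ord0 i3)) ^+ 2 +
    (val p ord0 i2 / (1 - val p ord0 i3)) ^+ 2 =
    (1 + val p ord0 i3) / (1 - val p ord0 i3).
  rewrite !expr_div_n -mulrDl.
  have -> : val p ord0 i1 ^+ 2 + val p ord0 i2 ^+ 2 =
    (1 + val p ord0 i3) * (1 - val p ord0 i3) by move: sp; lra.
  by field.
have e' : (1 + val p ord0 i3) / (1 - val p ord0 i3) + 1 != 0.
  have -> : (1 + val p ord0 i3) / (1 - val p ord0 i3) + 1 = 2 / (1 - val p ord0 i3).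
    by field.
  by rewrite mulf_neq0 ?invr_eq0.
by apply: vec3P; rewrite !vec3E e; field; rewrite p3 /=; apply/eqP; lra.
Qed.

Lemma south_chart : south R = chart_inv true 0.
Proof.
apply: val_inj; rewrite val_chart_inv /south val_to_S2 ?on_sphereE; last first.
  by rewrite /south_v !vec3E expr0n /= !add0r sqrrN expr1n.
by apply: vec3P; rewrite /south_v !vec3E !mxE; field.
Qed.

Lemma stereoC_invE z : stereoC_inv z = chart_inv true (vec2 (complex.Re z) (complex.Im z)).
Proof. by case: z. Qed.

Lemma stereoC_invK : cancel (@stereoC_inv R) (@stereoC R).
Proof. by case=> x y; rewrite /stereoC stereoC_invE chart_invK !vec2E. Qed.

Lemma stereoCK p : p <> north R -> stereoC_inv (stereoC p) = p.
Proof.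
by move=> pN; rewrite stereoC_invE /stereoC; cbn [complex.Re complex.Im];
  rewrite -vec2_eta chartK.
Qed.

Lemma stereoC_inv_neq_north z : stereoC_inv z <> north R.
Proof. by rewrite stereoC_invE; exact: chart_inv_neq_north. Qed.

(* The point of [S2] with homogeneous coordinates [z : w] (meaningless at [z = w = 0]). *)
Definition hpt z w : S2 R := if w == 0 then north R else stereoC_inv (z / w).

Lemma hpt_surj p : exists z w, [/\ (z != 0) || (w != 0) & p = hpt z w].
Proof.
case: (pselect (p = north R)) => [->|pN].
  by exists 1, 0; split; rewrite ?oner_eq0 // /hpt eqxx.
by exists (stereoC p), 1; split; rewrite /hpt ?oner_eq0 ?orbT // divr1 stereoCK.
Qed.

Lemma hptZ (k z w : R[i]) : k != 0 -> hpt (k * z) (k * w) = hpt z w.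
Proof.
move=> k0; rewrite /hpt mulf_eq0 (negPf k0) /=; case: eqVneq => // w0.
by congr stereoC_inv; field; rewrite w0 k0.
Qed.

(** A Moebius map is the linear action of its matrix on homogeneous coordinates, so [north] needs no
    separate case in what follows. *)
Lemma mob_hpt (a b c d z w : R[i]) : a * d - b * c != 0 -> (z != 0) || (w != 0) ->
  mob_map a b c d (hpt z w) = hpt (a * z + b * w) (c * z + d * w).
Proof.
move=> D zw; rewrite /mob_map {1 2}/hpt; case: (eqVneq w 0) => [w0|w0].
  move: zw; rewrite w0 !eqxx /= !mulr0 !addr0 orbF => z0.
  rewrite /hpt mulf_eq0 (negPf z0) orbF; case: eqVneq => // c0.
  by congr stereoC_inv; field; rewrite z0 c0.
rewrite ifF; last by apply/eqP/stereoC_inv_neq_north.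
rewrite (_ : hpt z w = stereoC_inv (z / w)); last by rewrite /hpt (negPf w0).
rewrite stereoC_invK /=.
have -> : c * (z / w) + d = (c * z + d * w) / w by field.
rewrite /hpt mulf_eq0 invr_eq0 (negPf w0) orbF; case: eqVneq => // cd0.
by congr stereoC_inv; field; rewrite w0 cd0.
Qed.

(** An invertible matrix kills no nonzero vector: the two identities multiply the image by the
    adjugate. *)
Lemma mob_nz (a b c d z w : R[i]) : a * d - b * c != 0 -> (z != 0) || (w != 0) ->
  (a * z + b * w != 0) || (c * z + d * w != 0).
Proof.
move=> D; apply: contraLR; rewrite !negb_or !negbK => /andP[/eqP e1 /eqP e2].
have : (a * d - b * c) * z = 0.
  have -> : (a * d - b * c) * z = d * (a * z + b * w) - b * (c * z + d * w) by ring.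
  by rewrite e1 e2 !mulr0 subr0.
have : (a * d - b * c) * w = 0.
  have -> : (a * d - b * c) * w = a * (c * z + d * w) - c * (a * z + b * w) by ring.
  by rewrite e1 e2 !mulr0 subr0.
move=> /eqP; rewrite mulf_eq0 (negPf D) /= => w0 /eqP; rewrite mulf_eq0 (negPf D) /= => z0.
by rewrite z0 w0.
Qed.

Lemma mob_comp (a b c d a' b' c' d' : R[i]) :
  a * d - b * c != 0 -> a' * d' - b' * c' != 0 ->
  mob_map a b c d \o mob_map a' b' c' d' =
  mob_map (a * a' + b * c') (a * b' + b * d') (c * a' + d * c') (c * b' + d * d').
Proof.
move=> D D'; apply/funext => p /=; have [z [w [zw ->]]] := hpt_surj p.
rewrite mob_hpt // mob_hpt //; last exact: mob_nz.
rewrite mob_hpt //.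
  by congr hpt; ring.
have -> : (a * a' + b * c') * (c * b' + d * d') - (a * b' + b * d') * (c * a' + d * c')
  = (a * d - b * c) * (a' * d' - b' * c') by ring.
by rewrite mulf_neq0.
Qed.

Lemma mobZ (k a b c d : R[i]) : k != 0 -> a * d - b * c != 0 ->
  mob_map (k * a) (k * b) (k * c) (k * d) = mob_map a b c d.
Proof.
move=> k0 D; apply/funext => p; have [z [w [zw ->]]] := hpt_surj p.
rewrite !mob_hpt //; last first.
  have -> : k * a * (k * d) - k * b * (k * c) = k * k * (a * d - b * c) by ring.
  by rewrite !mulf_neq0.
by rewrite -!mulrA -!mulrDr hptZ.
Qed.

Lemma mob_Mob (a b c d : R[i]) : a * d - b * c != 0 -> @Mob R (mob_map a b c d).
Proof.
(* [Mob] asks for determinant 1, so all coefficients are divided by a complex square root of the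
   determinant. *)
move=> D; set k := (sqrtc (a * d - b * c))^-1.
have k2 : k * k * (a * d - b * c) = 1.
  rewrite /k -invrM ?unitfE ?sqrtc_eq0 // -expr2 sqr_sqrtc mulVf //.
have k0 : k != 0 by rewrite invr_eq0 sqrtc_eq0.
exists (k * a), (k * b), (k * c), (k * d); split; last by rewrite mobZ.
by rewrite -k2; ring.
Qed.

(** * Rotations of the sphere as Moebius maps *)

Lemma divcE (x y m n : R) : m +i* n != 0 ->
  (x +i* y) / (m +i* n) = ((x * m + y * n) / (m ^+ 2 + n ^+ 2)) +i*
    ((y * m - x * n) / (m ^+ 2 + n ^+ 2)).
Proof.
move=> w0; have D : m ^+ 2 + n ^+ 2 != 0.
  apply: contra w0; rewrite paddr_eq0 ?sqr_ge0 // !sqrf_eq0 => /andP[/eqP-> /eqP->].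
  by [].
by apply: (mulIf w0); rewrite divfK //; simpc; congr Complex; field.
Qed.

(** This is the Hopf map: for [z = x + iy] and [w = m + in] the coordinates are the real and
    imaginary parts of [2 z conj(w)] and [|z|^2 - |w|^2], divided by [|z|^2 + |w|^2]. The formula
    also covers [north], so maps can be compared coordinate by coordinate. *)
Lemma val_hpt (x y m n : R) : (x +i* y != 0) || (m +i* n != 0) ->
  let N := x ^+ 2 + y ^+ 2 + m ^+ 2 + n ^+ 2 in
  N != 0 /\ val (hpt (x +i* y) (m +i* n)) =
    vec3 (2 * (x * m + y * n) / N) (2 * (y * m - x * n) / N)
         ((x ^+ 2 + y ^+ 2 - m ^+ 2 - n ^+ 2) / N).
Proof.
move=> zw N; have N0 : N != 0.
  apply: contraTneq zw => e; rewrite negb_or !negbK !eq_complex /=.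
  have := sqr_ge0 x; have := sqr_ge0 y; have := sqr_ge0 m; have := sqr_ge0 n.
  move: e; rewrite /N => e h1 h2 h3 h4.
  by rewrite -!(sqrf_eq0 x) -!(sqrf_eq0 y) -!(sqrf_eq0 m) -!(sqrf_eq0 n);
    repeat (apply/andP; split); apply/eqP; lra.
split=> //; move: zw; rewrite /hpt; case: (eqVneq (m +i* n) 0) => [/eqP|w0 _].
  rewrite eq_complex /= => /andP[/eqP m0 /eqP n0] _.
  move: N0; rewrite /N m0 n0 expr0n /= !addr0 => N0.
  by apply: vec3P; rewrite /= /north_v !vec3E; field.
have D : m ^+ 2 + n ^+ 2 != 0.
  apply: contra w0; rewrite paddr_eq0 ?sqr_ge0 // !sqrf_eq0 => /andP[/eqP-> /eqP->].
  by [].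
rewrite divcE // val_chart_inv !vec2E.
have e : ((x * m + y * n) / (m ^+ 2 + n ^+ 2)) ^+ 2 +
    ((y * m - x * n) / (m ^+ 2 + n ^+ 2)) ^+ 2 =
    (x ^+ 2 + y ^+ 2) / (m ^+ 2 + n ^+ 2) by field.
by rewrite e; apply: vec3P; rewrite !vec3E /N; field; rewrite D andbT.
Qed.

Definition mx3 (l : seq (seq R)) : 'M[R]_3 := \matrix_(i, j) (nth [::] l i)`_j.

Lemma mulmx3E (v : 'rV[R]_3) l (k : 'I_3) : (v *m mx3 l) ord0 k =
  v ord0 i1 * (nth [::] l 0)`_k + v ord0 i2 * (nth [::] l 1)`_k
  + v ord0 i3 * (nth [::] l 2)`_k.
Proof. by rewrite mxE sum3 !mxE. Qed.

Lemma det_mx2 (M : 'M[R]_2) :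
  \det M = M j1 j1 * M j2 j2 - M j1 j2 * M j2 j1.
Proof.
rewrite (expand_det_row _ j1) !big_ord_recr big_ord0 /= add0r /cofactor !det_mx11 !mxE /=.
rewrite (_ : widen_ord _ _ = j1); last exact: val_inj.
rewrite (_ : ord_max = j2); last exact: val_inj.
rewrite (_ : lift j1 0 = j2); last exact: val_inj.
rewrite (_ : lift j2 0 = j1); last exact: val_inj.
by rewrite /= expr0 expr1; ring.
Qed.

Lemma det_mx3 (a b c d e f g h k : R) :
  \det (mx3 [:: [:: a; b; c]; [:: d; e; f]; [:: g; h; k]]) =
  a * (e * k - f * h) - b * (d * k - f * g) + c * (d * h - e * g).
Proof.
rewrite (expand_det_row _ i1) sum3 /cofactor !det_mx2 !mxE /=.
by rewrite /bump /= !expr2 expr0 expr1; ring.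
Qed.

Lemma mx3_orth (a b c d e f g h k : R) :
  a * a + b * b + c * c = 1 -> d * d + e * e + f * f = 1 -> g * g + h * h + k * k = 1 ->
  a * d + b * e + c * f = 0 -> a * g + b * h + c * k = 0 -> d * g + e * h + f * k = 0 ->
  let M := mx3 [:: [:: a; b; c]; [:: d; e; f]; [:: g; h; k]] in M *m M^T = 1%:M.
Proof.
move=> e1 e2 e3 e4 e5 e6 M; apply/matrixP => i j; rewrite !mxE sum3 !mxE.
case: i => [[|[|[|//]]] lt_i]; case: j => [[|[|[|//]]] lt_j] /=;
  by rewrite ?mulr1n ?mulr0n; lra.
Qed.

Lemma on_sphere_orth (M : 'M[R]_3) p : M *m M^T = 1%:M -> on_sphere (val p *m M).
Proof.
move=> MM; rewrite /on_sphere; set v := val p *m M.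
have -> : \sum_k v ord0 k ^+ 2 = (v *m v^T) ord0 ord0.
  by rewrite [RHS]mxE; apply: eq_bigr => k _; rewrite [v^T _ _]mxE expr2.
rewrite /v trmx_mul mulmxA -(mulmxA (val p)) MM mulmx1 mxE.
have /eqP e : on_sphere (val p) := valP p; rewrite -[X in _ == X]e; apply/eqP.
by apply: eq_bigr => k _; rewrite mxE expr2.
Qed.

(** Multiplication by a unit complex number is a rotation about the axis through the two poles. *)
Lemma zrot_Rot (c s : R) : c ^+ 2 + s ^+ 2 = 1 -> Rot (mob_map (c +i* s) 0 0 1).
Proof.
move=> cs; exists (mx3 [:: [:: c; s; 0]; [:: - s; c; 0]; [:: 0; 0; 1]]).
set M := mx3 _.
have MM : M *m M^T = 1%:M by apply: mx3_orth; move: cs; rewrite ?expr2 => cs; lra.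
split=> //; split; first by rewrite det_mx3; move: cs; rewrite !expr2 => cs; lra.
have e0 : c +i* s != 0.
  by rewrite eq_complex /=; apply: contraL (oner_neq0 R) => /andP[/eqP c0 /eqP s0];
    rewrite -cs c0 s0 expr0n addr0 eqxx.
apply/funext => p; have [[x y] [[m n] [zw ->]]] := hpt_surj p.
apply: val_inj; rewrite mob_hpt ?mulr1 ?mulr0 ?subr0 // !mul0r mul1r addr0 add0r.
rewrite val_to_S2; last exact: on_sphere_orth.
have nz : ((c +i* s) * (x +i* y) != 0) || (m +i* n != 0) by rewrite mulf_eq0 (negPf e0).
move: nz; simpc => nz.
have [N0 ->] := val_hpt nz; have [N1 ->] := val_hpt zw.
have E : (c * x - s * y) ^+ 2 + (c * y + s * x) ^+ 2 = x ^+ 2 + y ^+ 2.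
  have -> : (c * x - s * y) ^+ 2 + (c * y + s * x) ^+ 2 =
    (c ^+ 2 + s ^+ 2) * (x ^+ 2 + y ^+ 2) by ring.
  by rewrite cs mul1r.
by rewrite E; apply: vec3P; rewrite mulmx3E !vec3E /=; field.
Qed.

(** A real matrix in SU(2) acts on the sphere as a rotation about the second coordinate axis through
    twice its angle; hence the double-angle expressions [C] and [S]. *)
Lemma yrot_Rot (c s : R) : c ^+ 2 + s ^+ 2 = 1 ->
  Rot (mob_map c%:C (- s)%:C s%:C c%:C)%C.
Proof.
move=> cs; pose C := c ^+ 2 - s ^+ 2; pose S := 2 * c * s.
exists (mx3 [:: [:: C; 0; - S]; [:: 0; 1; 0]; [:: S; 0; C]]).
set M := mx3 _.
have CS : C * C + S * S = 1.
  rewrite -[RHS](expr1n _ 2) -cs /C /S; ring.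
have MM : M *m M^T = 1%:M by apply: mx3_orth; lra.
split=> //; split; first by rewrite det_mx3; lra.
have D : (c%:C * c%:C - (- s)%:C * s%:C)%C != 0.
  have -> : (c%:C * c%:C - (- s)%:C * s%:C)%C = ((c ^+ 2 + s ^+ 2)%:C)%C.
    by simpc; congr Complex; ring.
  by rewrite cs oner_eq0.
apply/funext => p; have [[x y] [[m n] [zw ->]]] := hpt_surj p.
have nz := mob_nz D zw.
apply: val_inj; rewrite mob_hpt //.
rewrite val_to_S2; last exact: on_sphere_orth.
move: nz; simpc => nz.
have [N0 ->] := val_hpt nz; have [N1 ->] := val_hpt zw.
have E : (c * x - s * m) ^+ 2 + (c * y - s * n) ^+ 2 + (s * x + c * m) ^+ 2
    + (s * y + c * n) ^+ 2 = x ^+ 2 + y ^+ 2 + m ^+ 2 + n ^+ 2.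
  by rewrite -[RHS]mul1r -cs; ring.
rewrite E; apply: vec3P; rewrite mulmx3E !vec3E /= /C /S; [by field| |by field].
rewrite mulr0 add0r mulr0 addr0 mulr1; congr (_ / _).
by rewrite -[y * m - x * n]mul1r -cs; ring.
Qed.

End Geometry.

(** * Differentiability of C^1 maps of the plane *)

Section Calculus.
Variable R : realType.
Implicit Types (g : 'rV[R]_2 -> 'rV[R]_2) (u h : 'rV[R]_2).

Lemma mx_coord_le m n (v : 'M[R]_(m, n)) i j : `|v i j| <= `|v|.
Proof. by rewrite [leRHS]/Num.Def.normr /= mx_normrE; exact: (le_bigmax _ _ (i, j)). Qed.

Lemma mx_coordB_le m n (v w : 'M[R]_(m, n)) i j : `|v i j - w i j| <= `|v - w|.
Proof. by have := mx_coord_le (v - w) i j; rewrite !mxE. Qed.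

Lemma mx_norm_le m n (v : 'M[R]_(m, n)) (c : R) : 0 <= c -> (forall i j, `|v i j| <= c) ->
  `|v| <= c.
Proof.
by move=> c0 vc; rewrite /Num.Def.normr /= mx_normrE (bigmax_le _ c0)//= => -[i j] _.
Qed.

Lemma e2E (i j : 'I_2) : e2 R i ord0 j = (j == i)%:R.
Proof. by rewrite mxE eqxx. Qed.

Lemma rV2_decomp h : h = h ord0 j1 *: e2 R j1 + h ord0 j2 *: e2 R j2.
Proof.
apply/rowP => -[[|[|//]] lt_i]; rewrite !mxE /= ?mulr1 ?mulr0 ?addr0 ?add0r;
  congr (h _ _); exact: val_inj.
Qed.

Lemma mulrV2 h (A : 'M[R]_2) : h *m A = h ord0 j1 *: row j1 A + h ord0 j2 *: row j2 A.
Proof. by rewrite {1}(rV2_decomp h) mulmxDl -!scalemxAl -!rowE. Qed.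

Lemma coord_affine (v w x y : 'rV[R]_2) (a b : R) j :
  (v - w - (a *: x + b *: y)) ord0 j = v ord0 j - w ord0 j - (a * x ord0 j + b * y ord0 j).
Proof. by rewrite !mxE. Qed.

(** Error of the linear approximation along a path of two axis-parallel segments: [a1], [a2] are the
    mean slopes and [d1], [d2] the partial derivatives at the base point. *)
Lemma telescope_lin (k0 k1 k2 a1 a2 x1 x2 d1 d2 : R) :
  k1 - k0 = a1 * x1 -> k2 - k1 = a2 * x2 ->
  k2 - k0 - (x1 * d1 + x2 * d2) = - ((d1 - a1) * x1) - (d2 - a2) * x2.
Proof.
move=> E1 E2; have -> : k2 - k0 = a1 * x1 + a2 * x2 by rewrite -E1 -E2; ring.
by ring.
Qed.

Lemma mulmxr_continuous (A : 'M[R]_2) : continuous (mulmxr A : 'rV[R]_2 -> 'rV[R]_2).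
Proof.
rewrite (_ : mulmxr A = fun h : 'rV[R]_2 =>
  h ord0 j1 *: row j1 A + h ord0 j2 *: row j2 A); last first.
  by apply/funext => h /=; rewrite mulrV2.
move=> h; apply: differentiable_continuous.
by apply: differentiableD; apply: differentiableZl; exact: differentiable_coord.
Qed.

(* Transpose of [Defs.jacobian], matching the convention that vectors are rows. *)
Definition dmx g u : 'M[R]_2 := \matrix_(i, j) ('D_(e2 R i) g u) ord0 j.

Lemma row_dmx g u i : row i (dmx g u) = 'D_(e2 R i) g u.
Proof. by apply/rowP => j; rewrite !mxE. Qed.

Lemma derive_line (k : 'rV[R]_2 -> R) u (v : 'rV[R]_2) (t : R) :
  derivable k (u + t *: v) v ->
  is_derive t 1 (fun s => k (u + s *: v)) ('D_v k (u + t *: v)).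
Proof.
move=> dk.
have e : (fun h : R => h^-1 *: (((fun s => k (u + s *: v)) \o shift t) (h *: 1) -
    k (u + t *: v))) = (fun h : R => h^-1 *: ((k \o shift (u + t *: v)) (h *: v) -
    k (u + t *: v))).
  apply/funext => h /=; congr (_ *: (k _ - _)).
  by rewrite [h *: 1]mulr1 scalerDl addrCA addrC.
by split; [rewrite /derivable e | rewrite /derive e].
Qed.

(** The sign of [t] is free, so the intermediate point is located by [|s| <= |t|], which also keeps
    it close to [u]. *)
Lemma MVT_line (k : 'rV[R]_2 -> R) u (v : 'rV[R]_2) (t : R) :
  (forall s : R, `|s| <= `|t| -> derivable k (u + s *: v) v) ->
  exists2 s, `|s| <= `|t| & k (u + t *: v) - k u = 'D_v k (u + s *: v) * t.
Proof.
move=> dk; pose phi (s : R) := k (u + s *: v).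
have dphi (s : R) : `|s| <= `|t| -> is_derive s 1 phi ('D_v k (u + s *: v)).
  by move=> st; apply: derive_line; exact: dk.
have cphi (s : R) : `|s| <= `|t| -> {for s, continuous phi}.
  move=> /dphi d; apply: differentiable_continuous; apply/derivable1_diffP.
  exact: ex_derive.
have phi0 : phi 0 = k u by rewrite /phi scale0r addr0.
have [t0|t0] := leP 0 t.
  have sub (s : R) : s \in `[0, t]%R -> `|s| <= `|t|.
    by rewrite in_itv /= => /andP[s0 st]; rewrite !ger0_norm.
  have [||c ct e] := @MVT_segment R phi (fun s => 'D_v k (u + s *: v)) 0 t t0.
  - by move=> s /subset_itv_oo_cc/sub/dphi.
  - by apply: continuous_in_subspaceT => s /set_mem/= /sub/cphi.
  by exists c; [exact: sub | rewrite -phi0 e subr0].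
have sub (s : R) : s \in `[t, 0]%R -> `|s| <= `|t|.
  by rewrite in_itv /= => /andP[ts s0]; rewrite !ler0_norm ?(ltW t0) // lerN2.
have [||c ct e] := @MVT_segment R phi (fun s => 'D_v k (u + s *: v)) t 0 (ltW t0).
- by move=> s /subset_itv_oo_cc/sub/dphi.
- by apply: continuous_in_subspaceT => s /set_mem/= /sub/cphi.
exists c; first exact: sub.
by rewrite -phi0 -[LHS]opprB e sub0r mulrN opprK.
Qed.

Lemma is_diff_linear_approx (V W : normedModType R) (f : V -> W) (df : {linear V -> W}) x :
  continuous df ->
  (forall e : R, 0 < e -> \forall h \near (0 : V), `|f (h + x) - f x - df h| <= e * `|h|) ->
  is_diff x f df.
Proof.
move=> cdf approx.
have key : f \o shift x = cst (f x) + df +o_ 0 id.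
  apply/eqaddoP => e /approx; apply: filterS => h /=.
  by rewrite -addrA -opprD.
have E : 'd f x = df :> (V -> W) by exact: diff_unique.
by split=> //; apply/diff_locallyP; rewrite E.
Qed.

(** Continuous partial derivatives give Frechet differentiability: the mean value theorem is applied
    along one axis and then the other, and continuity bounds the change of each partial derivative
    by [e / 2]. *)
Lemma C1_diff (U : set 'rV[R]_2) g u : C1_on U g -> U u ->
  is_diff u g (mulmxr (dmx g u)).
Proof.
move=> [oU C1g] Uu; apply: is_diff_linear_approx; first exact: mulmxr_continuous.
move=> _/posnumP[e].
have nU : \forall w \near u, U w by exact: open_nbhs_nbhs.
have nD j : \forall w \near u, `|'D_(e2 R j) g u - 'D_(e2 R j) g w| < e%:num / 2.
  have /cvgrPdist_lt := (C1g j).2 u Uu; apply; exact: divr_gt0.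
have : \forall w \near u, [/\ U w,
   `|'D_(e2 R j1) g u - 'D_(e2 R j1) g w| < e%:num / 2 &
   `|'D_(e2 R j2) g u - 'D_(e2 R j2) g w| < e%:num / 2].
  by apply: filterS (filterI nU (filterI (nD j1) (nD j2))) => w [? [? ?]]; split.
move=> /nbhs_normP[r /= r0 Br].
apply/nbhs_norm0P; exists r => //= h hr.
have B w : `|w - u| <= `|h| -> [/\ U w,
   `|'D_(e2 R j1) g u - 'D_(e2 R j1) g w| < e%:num / 2 &
   `|'D_(e2 R j2) g u - 'D_(e2 R j2) g w| < e%:num / 2].
  by move=> wh; apply: Br; rewrite /= distrC (le_lt_trans wh).
have h1 := mx_coord_le h ord0 j1; have h2 := mx_coord_le h ord0 j2.
apply: mx_norm_le; first by rewrite mulr_ge0.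
move=> i j; rewrite ord1 {i}.
pose k w := g w ord0 j.
have dk i w : U w -> derivable k w (e2 R i).
  by move=> Uw; have /derivable_mxP := (C1g i).1 w Uw; exact.
have Dk i w : U w -> 'D_(e2 R i) k w = 'D_(e2 R i) g w ord0 j.
  by move=> Uw; rewrite (derive_mx ((C1g i).1 w Uw)) mxE.
(* In the maximum norm both segments of the path stay within distance [|h|] of [u]. *)
have near1 (s : R) : `|s| <= `|h ord0 j1| -> `|u + s *: e2 R j1 - u| <= `|h|.
  move=> sh; rewrite addrAC subrr add0r; apply: mx_norm_le => // a b.
  rewrite mxE ord1 e2E normrM; case: eqP => _; last by rewrite normr0 mulr0.
  by rewrite normr1 mulr1 (le_trans sh).
have near2 (s : R) : `|s| <= `|h ord0 j2| ->
    `|u + h ord0 j1 *: e2 R j1 + s *: e2 R j2 - u| <= `|h|.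
  move=> sh; rewrite [X in `|X|](_ : _ =
    h ord0 j1 *: e2 R j1 + s *: e2 R j2); last by apply/rowP => i; rewrite !mxE; ring.
  apply: mx_norm_le => // a b.
  rewrite (ord1 a) !mxE eqxx -!val_eqE; case: b => -[|[|//]] lt_b /=.
    by rewrite mulr1 mulr0 addr0.
  by rewrite mulr1 mulr0 add0r (le_trans sh).
have [|s1 sh1 E1] := @MVT_line k u (e2 R j1) (h ord0 j1).
  by move=> s /near1/B[Us _ _]; exact: dk.
have [|s2 sh2 E2] := @MVT_line k (u + h ord0 j1 *: e2 R j1) (e2 R j2) (h ord0 j2).
  by move=> s /near2/B[Us _ _]; exact: dk.
have [U1 b1 _] := B _ (near1 _ sh1).
have [U2 _ b2] := B _ (near2 _ sh2).
rewrite !Dk // in E1 E2.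
set a1 := (X in X * _) in E1; set a2 := (X in X * _) in E2.
have c1 := mx_coordB_le ('D_(e2 R j1) g u) ('D_(e2 R j1) g (u + s1 *: e2 R j1)) ord0 j.
have c2 := mx_coordB_le ('D_(e2 R j2) g u)
  ('D_(e2 R j2) g (u + h ord0 j1 *: e2 R j1 + s2 *: e2 R j2)) ord0 j.
rewrite -/a1 in c1; rewrite -/a2 in c2.
have -> : (g (h + u) - g u - mulmxr (dmx g u) h) ord0 j =
   - (('D_(e2 R j1) g u ord0 j - a1) * h ord0 j1) -
   ('D_(e2 R j2) g u ord0 j - a2) * h ord0 j2.
  rewrite /= mulrV2 !row_dmx coord_affine.
  have -> : g (h + u) ord0 j = k (u + h ord0 j1 *: e2 R j1 + h ord0 j2 *: e2 R j2).
    by rewrite /k -addrA -rV2_decomp addrC.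
  have -> : g u ord0 j = k u by [].
  exact: telescope_lin E1 E2.
have l1 := le_lt_trans c1 b1; have l2 := le_lt_trans c2 b2.
apply: (le_trans (ler_normD _ _)); rewrite !normrN !normrM.
have -> : e%:num * `|h| = e%:num / 2 * `|h| + e%:num / 2 * `|h| by field.
apply: lerD; (apply: ler_pM; [exact: normr_ge0 | exact: normr_ge0 | |]).
- exact: (ltW l1).
- exact: h1.
- exact: (ltW l2).
- exact: h2.
Qed.

Lemma dmx_diff g u (A : 'M[R]_2) : is_diff u g (mulmxr A) -> dmx g u = A.
Proof.
move=> dg; apply/row_matrixP => i; rewrite row_dmx deriveE ?diff_val /= -?rowE //.
Qed.

(** Vectors are rows, so the matrix of the inner map stands on the left. *)
Lemma dmx_comp f g u (A B : 'M[R]_2) : is_diff u g (mulmxr A) ->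
  is_diff (g u) f (mulmxr B) -> is_diff u (f \o g) (mulmxr (A *m B)).
Proof.
move=> dg df; apply: (is_diff_eq (is_diff_comp dg df)).
by apply/funext => h /=; rewrite mulmxA.
Qed.

Lemma dmx_near f g u : (\forall w \near u, f w = g w) -> dmx f u = dmx g u.
Proof. by move=> fg; apply/row_matrixP => i; rewrite !row_dmx (near_eq_derive _ fg). Qed.

End Calculus.

(** * Rotations of the plane *)

Section PlaneRotations.
Variable R : realType.
Implicit Types (u w : 'rV[R]_2) (c s : R) (A : 'M[R]_2).

(** Acting on rows from the right, this is multiplication by [c + is]; it is a rotation only when
    [c^2 + s^2 = 1]. *)
Definition rot2 c s : 'M[R]_2 := \matrix_(i, j) (nth [::] [:: [:: c; s]; [:: - s; c]] i)`_j.

Lemma sum2 (F : 'I_2 -> R) : \sum_k F k = F j1 + F j2.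
Proof.
rewrite !big_ord_recr big_ord0 /= add0r.
by congr (F _ + F _); apply: val_inj.
Qed.

Lemma mulmx2E (m : nat) (B : 'M[R]_(m, 2)) A i j :
  (B *m A) i j = B i j1 * A j1 j + B i j2 * A j2 j.
Proof. by rewrite mxE sum2. Qed.

Lemma rot2E c s : (rot2 c s j1 j1 = c) * (rot2 c s j1 j2 = s) *
  (rot2 c s j2 j1 = - s) * (rot2 c s j2 j2 = c).
Proof. by rewrite !mxE. Qed.

Lemma mx2P A (B : 'M[R]_2) : A j1 j1 = B j1 j1 -> A j1 j2 = B j1 j2 -> A j2 j1 = B j2 j1 ->
  A j2 j2 = B j2 j2 -> A = B.
Proof.
move=> e11 e12 e21 e22; have I2 (i : 'I_2) : i = j1 \/ i = j2.
  by case: i => -[|[|//]] lt_i; [left | right]; exact: val_inj.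
by apply/matrixP => i j; case: (I2 i) => ->; case: (I2 j) => ->.
Qed.

Lemma mul_rot2E u c s : u *m rot2 c s =
  vec2 (u ord0 j1 * c - u ord0 j2 * s) (u ord0 j1 * s + u ord0 j2 * c).
Proof. by apply: vec2P; rewrite mulmx2E !rot2E !vec2E ?mulrN. Qed.

Lemma vec2_0 : vec2 0 0 = 0 :> 'rV[R]_2.
Proof. by apply: vec2P; rewrite vec2E mxE. Qed.

Lemma rV2_neq0 u : u != 0 -> 0 < u ord0 j1 ^+ 2 + u ord0 j2 ^+ 2.
Proof.
move=> u0; rewrite lt_neqAle addr_ge0 ?sqr_ge0 // andbT eq_sym.
apply: contra u0; rewrite paddr_eq0 ?sqr_ge0 // !sqrf_eq0 => /andP[/eqP e1 /eqP e2].
by rewrite (vec2_eta u) e1 e2 vec2_0.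
Qed.

Lemma rot2_transitive u w : u != 0 ->
  u ord0 j1 ^+ 2 + u ord0 j2 ^+ 2 = w ord0 j1 ^+ 2 + w ord0 j2 ^+ 2 ->
  exists c s, c ^+ 2 + s ^+ 2 = 1 /\ u *m rot2 c s = w.
Proof.
move=> /rV2_neq0 /lt0r_neq0; rewrite (vec2_eta w) (vec2_eta u) !vec2E.
move: (u ord0 j1) (u ord0 j2) (w ord0 j1) (w ord0 j2) => a b a' b' n0 e.
(* The real and imaginary parts of the quotient [w / u] of complex numbers. *)
exists ((a * a' + b * b') / (a ^+ 2 + b ^+ 2)), ((a * b' - b * a') / (a ^+ 2 + b ^+ 2)).
split; last by rewrite mul_rot2E; apply: vec2P; rewrite !vec2E; field.
rewrite !expr_div_n -mulrDl.
have -> : (a * a' + b * b') ^+ 2 + (a * b' - b * a') ^+ 2 =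
  (a ^+ 2 + b ^+ 2) * (a' ^+ 2 + b' ^+ 2) by ring.
by rewrite -e; field.
Qed.

(** Conjugate matrices have equal traces, so [c' = c] and [s' = s] or [- s]. In the second case [s]
    times the sum of [\det A] and the squared norm of the first row of [A] vanishes; that sum is
    positive, so [s = 0]. *)
Lemma rot2_conj A c s c' s' : 0 < \det A -> c ^+ 2 + s ^+ 2 = 1 -> c' ^+ 2 + s' ^+ 2 = 1 ->
  rot2 c s *m A = A *m rot2 c' s' -> c' = c /\ s' = s.
Proof.
rewrite det_mx2 => D cs cs' E.
have := congr1 (fun M : 'M[R]_2 => M j1 j1) E; have := congr1 (fun M : 'M[R]_2 => M j1 j2) E.
have := congr1 (fun M : 'M[R]_2 => M j2 j1) E; have := congr1 (fun M : 'M[R]_2 => M j2 j2) E.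
rewrite !mulmx2E !rot2E; move: D.
move: (A j1 j1) (A j1 j2) (A j2 j1) (A j2 j2) => a b p q D e22 e21 e12 e11.
have D0 := lt0r_neq0 D.
have Ec : c' = c.
  (* With [X] the difference of the two sides of [E], this is the trace of [X] times the adjugate of
     [A]. *)
  have : (c' - c) * (2 * (a * q - b * p)) = 0.
    have -> : (c' - c) * (2 * (a * q - b * p)) =
      (a * c' + b * - s' - (c * a + s * p)) * q
      + (p * s' + q * c' - (- s * b + c * q)) * a
      - (a * s' + b * c' - (c * b + s * q)) * p
      - (p * c' + q * - s' - (- s * a + c * p)) * b by ring.
    by rewrite e11 e12 e21 e22 !subrr !mul0r; ring.
  by move=> /eqP; rewrite !mulf_eq0 (negPf D0) pnatr_eq0 /= orbF subr_eq0 => /eqP.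
(* The first row of [E], paired with [(- b, a)]. *)
have Es : s * (a * q - b * p) = s' * (a ^+ 2 + b ^+ 2).
  have -> : s * (a * q - b * p) = - (c * a + s * p) * b + (c * b + s * q) * a by ring.
  by rewrite e11 e12; ring.
have s2 : (s' - s) * (s' + s) = 0.
  have : s' ^+ 2 = s ^+ 2 by move: cs cs'; rewrite Ec; lra.
  by move=> e; rewrite -subr_sqr e subrr.
split=> //; move: s2 => /eqP; rewrite mulf_eq0 subr_eq0 => /orP[/eqP//|].
rewrite addr_eq0 => /eqP s's; move: Es; rewrite s's mulNr => Es.
have : s * (a ^+ 2 + b ^+ 2 + (a * q - b * p)) = 0 by rewrite mulrDr Es addrN.
move=> /eqP; rewrite mulf_eq0 => /orP[/eqP->|]; first by rewrite oppr0.
by rewrite gt_eqF // ltr_wpDl // addr_ge0 ?sqr_ge0.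
Qed.

(** * The unit circle and periodic functions *)

Definition circ (t : R) : 'rV[R]_2 := cos t *: e2 R j1 + sin t *: e2 R j2.

Lemma circE t : circ t = vec2 (cos t) (sin t).
Proof. by apply: vec2P; rewrite !mxE /= ?mulr1 ?mulr0 ?addr0 ?add0r. Qed.

Lemma circD t d : circ (t + d) = circ t *m rot2 (cos d) (sin d).
Proof.
rewrite !circE mul_rot2E !vec2E cosD sinD; congr vec2.
by ring.
Qed.

Lemma circ_neq0 t : circ t != 0.
Proof.
apply/eqP => e; have := cos2Dsin2 t.
have := congr1 (fun u : 'rV[R]_2 => u ord0 j1) e.
have := congr1 (fun u : 'rV[R]_2 => u ord0 j2) e.
rewrite circE !vec2E !mxE => -> ->; rewrite expr0n addr0 => /eqP.
by rewrite eq_sym oner_eq0.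
Qed.

Lemma unit_angle c s : c ^+ 2 + s ^+ 2 = 1 ->
  exists d : R, [/\ 0 <= d, d <= pi *+ 2, cos d = c & sin d = s].
Proof.
move=> cs; have c1 : -1 <= c <= 1.
  by rewrite -ler_norml -(@expr_le1 _ 2) // real_normK ?num_real // -cs lerDl sqr_ge0.
have Ca : cos (acos c) = c by rewrite acosK // in_itv.
have Sa : sin (acos c) = `|s|.
  by rewrite sin_acos // -cs addrAC subrr add0r sqrtr_sqr.
have [a0 api] := (acos_ge0 c1, acos_lepi c1).
have p0 := pi_ge0 R.
have [s0|s0] := leP 0 s.
  exists (acos c); split=> //; first by rewrite mulr2n ler_wpDr.
  by rewrite Sa ger0_norm.
exists (pi *+ 2 - acos c); split.
- by rewrite mulr2n; lra.
- by rewrite lerBlDr lerDl.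
- by rewrite cosB cos2pi sin2pi mul1r mul0r addr0.
- by rewrite sinB cos2pi sin2pi mul0r mul1r sub0r Sa ltr0_norm // opprK.
Qed.

(** At a maximum point [m] the difference [f (t + d) - f t] is nonpositive, and at [m - d] it is
    nonnegative; the intermediate value theorem gives a zero in between. *)
Lemma periodic_chord (f : R -> R) (T d : R) : continuous f -> (forall x, f (x + T) = f x) ->
  0 <= d -> d <= T -> exists t, f (t + d) = f t.
Proof.
move=> cf per d0 dT; have T0 := le_trans d0 dT.
have [m + fm] := EVT_max T0 (continuous_subspaceT cf).
rewrite in_itv /= => /andP[m0 mT].
(* Periodicity extends the maximum from [[0, T]] to an interval that contains [m - d] and
   [m + d]. *)
have fm' x : - T <= x -> x <= T + T -> f x <= f m.
  move=> lx rx; have [x0|x0] := ltP x 0.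
    by rewrite -per fm // in_itv /=; apply/andP; split; lra.
  have [xT|xT] := leP x T; first by rewrite fm // in_itv /= x0.
  by rewrite -[x](subrK T) per fm // in_itv /=; apply/andP; split; lra.
pose v t := f (t + d) - f t.
have cv : continuous v.
  move=> t; apply: cvgB; last exact: cf.
  apply: (@continuous_comp _ _ _ (fun t => t + d) f); last exact: cf.
  by apply: cvgD; [exact: cvg_id | exact: cvg_cst].
have v1 : 0 <= v (m - d) by rewrite /v subrK subr_ge0 fm' //; lra.
have v2 : v m <= 0 by rewrite /v subr_le0 fm' //; lra.
have md : m - d <= m by lra.
have [|t _ vt] := @IVT R v (m - d) m 0 md (continuous_subspaceT cv).
  by rewrite ge_min le_max v1 v2 orbT.
by exists t; apply/eqP; rewrite -subr_eq0; apply/eqP.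
Qed.

End PlaneRotations.

(** * Local expressions in the stereographic chart *)

Section Charts.
Variable R : realType.
Implicit Types (f g : S2 R -> S2 R) (u w v : 'rV[R]_2) (c s : R) (A : 'M[R]_2).

(** Where [f] takes the value [north], the chart divides by zero and returns the junk value 0; hence
    the side conditions [<> north R] below. *)
Definition plane_map f : 'rV[R]_2 -> 'rV[R]_2 := chart_expr f true true.

Lemma plane_mapK f u : f (chart_inv true u) <> north R ->
  chart_inv true (plane_map f u) = f (chart_inv true u).
Proof. exact: chartK. Qed.

Lemma plane_map_eq f u w : f (chart_inv true u) = chart_inv true w -> plane_map f u = w.
Proof. by rewrite /plane_map /chart_expr => ->; rewrite chart_invK. Qed.

Lemma plane_map_diff f u : Diff1plus f -> f (chart_inv true u) <> north R ->
  is_diff u (plane_map f) (mulmxr (dmx (plane_map f) u)).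
Proof. by move=> [C1f _] fu; exact: (C1_diff (C1f true true)). Qed.

Lemma det_plane_map f u : Diff1plus f -> f (chart_inv true u) <> north R ->
  0 < \det (dmx (plane_map f) u).
Proof.
move=> [_ [orf _]] fu; have := orf true true u fu; rewrite -det_tr.
by rewrite (_ : (_)^T = dmx (plane_map f) u) //; apply/matrixP => i j; rewrite !mxE.
Qed.

Lemma near_chart_dom f u : Diff1plus f -> f (chart_inv true u) <> north R ->
  \forall w \near u, f (chart_inv true w) <> north R.
Proof. by move=> [C1f _] fu; have [oU _] := C1f true true; exact: open_nbhs_nbhs. Qed.

(** The inner charts cancel only where [g] avoids [north]; this holds near [u] because chart domains
    are open. *)
Lemma dmx_chain f g u : Diff1plus f -> Diff1plus g ->
  g (chart_inv true u) <> north R -> f (g (chart_inv true u)) <> north R ->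
  dmx (plane_map (f \o g)) u =
  dmx (plane_map g) u *m dmx (plane_map f) (plane_map g u).
Proof.
move=> Df Dg gu fgu.
rewrite (@dmx_near _ (plane_map (f \o g)) (plane_map f \o plane_map g)); last first.
  apply: filterS (near_chart_dom Dg gu) => w gw.
  by rewrite /comp /plane_map /chart_expr chartK.
apply: dmx_diff; apply: dmx_comp; first exact: plane_map_diff.
by apply: plane_map_diff => //; rewrite plane_mapK.
Qed.

Lemma dmx_mulmxr A u : dmx (mulmxr A) u = A.
Proof.
apply: dmx_diff; apply: is_diff_linear_approx; first exact: mulmxr_continuous.
move=> e e0; apply/nbhs_norm0P; exists 1 => //= h _; rewrite mulmxDl addrK subrr normr0.
by rewrite mulr_ge0 // ltW.
Qed.

Lemma chart_inv_stereo u : chart_inv true u = stereoC_inv (u ord0 j1 +i* u ord0 j2).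
Proof. by rewrite stereoC_invE /= -vec2_eta. Qed.

Lemma mob_stereo (a b c d z : R[i]) : c * z + d != 0 ->
  mob_map a b c d (stereoC_inv z) = stereoC_inv ((a * z + b) / (c * z + d)).
Proof.
move=> D; rewrite /mob_map ifF; last by apply/eqP/stereoC_inv_neq_north.
by rewrite stereoC_invK /= (negPf D).
Qed.

Lemma dilate_north z : @mob_map R z 0 0 1 (north R) = north R.
Proof. by rewrite /mob_map !eqxx. Qed.

Lemma dilate_chart (a b : R) u :
  mob_map (a +i* b) 0 0 1 (chart_inv true u) = chart_inv true (u *m rot2 a b).
Proof.
rewrite !chart_inv_stereo mob_stereo mul0r add0r ?oner_eq0 // divr1 addr0.
by congr stereoC_inv; rewrite mul_rot2E !vec2E; simpc; congr Complex; ring.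
Qed.

Lemma plane_map_dilate (a b : R) : plane_map (mob_map (a +i* b) 0 0 1) = mulmxr (rot2 a b).
Proof. by apply/funext => u; apply: plane_map_eq; rewrite dilate_chart. Qed.

(** * Rotations about the second axis in the chart *)

Definition yrot c s : S2 R -> S2 R := mob_map c%:C (- s)%:C s%:C c%:C.

Lemma yrot_plane c s u : (s * u ord0 j1 + c) ^+ 2 + (s * u ord0 j2) ^+ 2 != 0 ->
  let N := (s * u ord0 j1 + c) ^+ 2 + (s * u ord0 j2) ^+ 2 in
  plane_map (yrot c s) u =
    vec2 (((c * u ord0 j1 - s) * (s * u ord0 j1 + c) + c * u ord0 j2 * (s * u ord0 j2)) / N)
         ((c * u ord0 j2 * (s * u ord0 j1 + c) - (c * u ord0 j1 - s) * (s * u ord0 j2)) / N).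
Proof.
move=> N0 N; apply: plane_map_eq; rewrite chart_inv_stereo /yrot.
have E1 : s%:C * (u ord0 j1 +i* u ord0 j2) + c%:C = (s * u ord0 j1 + c) +i* (s * u ord0 j2).
  by simpc; congr Complex; ring.
have E2 : c%:C * (u ord0 j1 +i* u ord0 j2) + (- s)%:C =
    (c * u ord0 j1 - s) +i* (c * u ord0 j2).
  by simpc; congr Complex; ring.
have D : (s * u ord0 j1 + c) +i* (s * u ord0 j2) != 0.
  apply: contra N0; rewrite eq_complex /= => /andP[/eqP -> /eqP ->].
  by rewrite expr0n addr0.
by rewrite mob_stereo E1 // E2 divcE // stereoC_invE.
Qed.

Lemma yrot_origin c s : c != 0 ->
  yrot c s (chart_inv true 0) = chart_inv true (vec2 (- s / c) 0).
Proof.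
move=> c0; rewrite !chart_inv_stereo /yrot !mxE.
have cC : c%:C != 0 by apply: contra c0; rewrite eq_complex /= => /andP[].
rewrite mob_stereo (_ : 0 +i* 0 = 0) // !mulr0 !add0r // -fmorph_div.
by congr stereoC_inv; rewrite !vec2E.
Qed.

(** When the difference quotient has a closed form [q] continuous at 0, the limit is read off by
    evaluation. *)
Lemma derive_quot (k : 'rV[R]_2 -> R) v (q : R -> R) :
  (\forall h \near (0 : R), k (h *: v) - k 0 = h * q h) -> {for 0, continuous q} ->
  'D_v k 0 = q 0.
Proof.
move=> kq cq; rewrite /derive; apply: cvg_lim => //.
have cq' : q h @[h --> 0^'] --> q 0 by apply: cvg_within_filter.
apply: cvg_trans cq'; apply: near_eq_cvg; rewrite near_withinE.
apply: filterS kq => h kh h0; rewrite /= addr0 kh.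
by rewrite /GRing.scale /= mulKf.
Qed.

(** The complex derivative of [(cz - s) / (sz + c)] is [(c^2 + s^2) / (sz + c)^2], which at 0 is the
    real number [c^-2]. The four entries are computed separately by [derive_quot]. *)
Lemma dmx_yrot c s : c != 0 -> c ^+ 2 + s ^+ 2 = 1 -> Diff1plus (yrot c s) ->
  dmx (plane_map (yrot c s)) 0 = (c ^- 2)%:M.
Proof.
move=> c0 cs DY.
have Y0 : yrot c s (chart_inv true 0) <> north R.
  by rewrite yrot_origin //; exact: chart_inv_neq_north.
have [dY _] := plane_map_diff DY Y0.
have Dij (i j : 'I_2) : dmx (plane_map (yrot c s)) 0 i j =
    'D_(e2 R i) (fun u => plane_map (yrot c s) u ord0 j) 0.
  by rewrite mxE derive_mx ?mxE //; exact: diff_derivable.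
have cM : c * c != 0 by rewrite mulf_neq0.
have plane0 : plane_map (yrot c s) 0 = vec2 (- s / c) 0.
  by apply: plane_map_eq; exact: yrot_origin.
have cid : {for (0 : R), continuous (fun h : R => h)} by exact: cvg_id.
have ccst (a : R) : {for (0 : R), continuous (fun h : R => a)} by exact: cvg_cst.
have cN : {for (0 : R), continuous (fun h : R => s * h + c)}.
  by apply: cvgD; [apply: cvgM; [exact: ccst|exact: cid]|exact: ccst].
have cN2 : {for (0 : R), continuous (fun h : R => c ^+ 2 + (s * h) ^+ 2)}.
  have csh : {for (0 : R), continuous (fun h : R => s * h)}.
    by apply: cvgM; [exact: ccst|exact: cid].
  by apply: cvgD; [exact: ccst|exact: (cvgM csh csh)].
have N2 (h : R) : c ^+ 2 + (s * h) ^+ 2 != 0.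
  by rewrite gt_eqF // ltr_pwDl ?sqr_ge0 // exprn_even_gt0.
have nz : \forall h \near (0 : R), s * h + c != 0.
  by apply: (cvgr_neq0 _ cN); rewrite mulr0 add0r.
have e1E (h : R) : (h *: e2 R j1) = vec2 h 0.
  by apply: vec2P; rewrite !mxE /= ?mulr1 ?mulr0.
have e2E (h : R) : (h *: e2 R j2) = vec2 0 h.
  by apply: vec2P; rewrite !mxE /= ?mulr1 ?mulr0.
apply: mx2P; rewrite Dij !mxE /= ?mulr1n ?mulr0n.
- rewrite (@derive_quot _ _ (fun h => (c * (s * h + c))^-1)).
  + by rewrite mulr0 add0r expr2.
  + apply: filterS nz => h hz; cbv beta; rewrite e1E plane0 yrot_plane !vec2E; last first.
      by rewrite mulr0 expr0n addr0 sqrf_eq0.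
    (* A factor [c^2 + s^2 = 1] is inserted to turn the claim into a rational identity in free [c]
       and [s]. *)
    have -> : (h * (c * (s * h + c))^-1) =
       (h * (c ^+ 2 + s ^+ 2)) * (c * (s * h + c))^-1 by rewrite cs mulr1.
    by field; rewrite ?c0 ?hz ?mulr0 ?expr0n ?addr0 ?sqrf_eq0 ?hz.
  + by apply: cvgV; [rewrite mulr0 add0r | apply: cvgM; [exact: ccst|exact: cN]].
- rewrite (@derive_quot _ _ (fun h => 0)) //.
  apply: filterS nz => h hz; cbv beta; rewrite e1E plane0 yrot_plane !vec2E; last first.
    by rewrite mulr0 expr0n addr0 sqrf_eq0.
  by rewrite !(mulr0, mul0r, subr0).
(* Along the imaginary axis the real part changes only to second order, so this quotient still has a
   factor [h]. *)
- rewrite (@derive_quot _ _ (fun h => s * h / (c * (c ^+ 2 + (s * h) ^+ 2)))).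
  + by rewrite mulr0 mul0r.
  + apply: filterS nz => h _; cbv beta; rewrite e2E plane0 yrot_plane !vec2E;
      last by rewrite mulr0 add0r.
    have -> : h * (s * h / (c * (c ^+ 2 + (s * h) ^+ 2))) =
      h * (s * h * (c ^+ 2 + s ^+ 2) / (c * (c ^+ 2 + (s * h) ^+ 2))) by rewrite cs mulr1.
    by field; rewrite ?c0 ?N2 ?mulr0 ?add0r ?N2.
  + apply: cvgM; first by apply: cvgM; [exact: ccst|exact: cid].
    apply: cvgV; [by rewrite mulf_neq0 | by apply: cvgM; [exact: ccst|exact: cN2]].
- rewrite (@derive_quot _ _ (fun h => (c ^+ 2 + (s * h) ^+ 2)^-1)).
  + by rewrite mulr0 expr0n addr0.
  + apply: filterS nz => h _; cbv beta; rewrite e2E plane0 yrot_plane !vec2E;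
      last by rewrite mulr0 add0r.
    rewrite !mulr0 !add0r.
    rewrite (_ : c * h * c - - s * (s * h) = h); last first.
      by rewrite -[RHS]mulr1 -cs; ring.
    by rewrite subr0.
  + by apply: cvgV; [exact: N2 | exact: cN2].
Qed.

End Charts.

(** * Sharply 3-transitive groups containing the rotations *)

Arguments chart_inv : simpl never.
Arguments chart : simpl never.

(** * Conformal matrices *)

Section Conformal.
Variable R : realType.
Implicit Types (A B : 'M[R]_2) (c s : R).

(** Commuting with the quarter turn states the Cauchy-Riemann equations in a form stable under
    products; the zero matrix is included. *)
Definition conformal A := rot2 0 1 *m A = A *m rot2 0 1.

Lemma rot2C a b c s : rot2 a b *m rot2 c s = rot2 c s *m rot2 a b :> 'M[R]_2.
Proof. by apply: mx2P; rewrite !mulmx2E !rot2E; ring. Qed.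

Lemma conformal_rot2 c s : conformal (rot2 c s).
Proof. exact: rot2C. Qed.

Lemma conformal_scalar (k : R) : conformal k%:M.
Proof. by rewrite /conformal scalar_mxC. Qed.

Lemma conformalM A B : conformal A -> conformal B -> conformal (A *m B).
Proof. by rewrite /conformal => cA cB; rewrite mulmxA cA -!mulmxA cB. Qed.

Lemma conformal_scale (k : R) A : k != 0 -> conformal (k%:M *m A) -> conformal A.
Proof.
rewrite /conformal mul_scalar_mx -scalemxAl -scalemxAr => k0.
by move=> /(congr1 (fun M => k^-1 *: M)); rewrite !scalerA mulVf // !scale1r.
Qed.

(** By Cayley-Hamilton, trace 0 would give [A *m A = - \det A], against positivity. With a nonzero
    trace, the entries of [A *m A = 1%:M] make [A] diagonal with equal diagonal entries. *)
Lemma sqr_id_scalar A : 0 < \det A -> A *m A = 1%:M -> exists2 k : R, k != 0 & A = k%:M.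
Proof.
rewrite det_mx2 => D E.
have := congr1 (fun M : 'M[R]_2 => M j1 j1) E; have := congr1 (fun M : 'M[R]_2 => M j1 j2) E.
have := congr1 (fun M : 'M[R]_2 => M j2 j1) E; have := congr1 (fun M : 'M[R]_2 => M j2 j2) E.
rewrite !mulmx2E !mxE /= ?mulr1n ?mulr0n.
move: D; set a := A j1 j1; set b := A j1 j2; set p := A j2 j1; set q := A j2 j2.
move=> D e22 e21 e12 e11.
have t0 : a + q != 0.
  by apply/eqP => t; have aq : q = - a by [lra]; move: D e11; rewrite aq; lra.
have b0 : b = 0.
  have : (a + q) * b = 0 by rewrite -e12; ring.
  by move=> /eqP; rewrite mulf_eq0 (negPf t0) /= => /eqP.
have p0 : p = 0.
  have : (a + q) * p = 0 by rewrite -e21; ring.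
  by move=> /eqP; rewrite mulf_eq0 (negPf t0) /= => /eqP.
have aq : a = q.
  have : (a + q) * (a - q) = 0.
    have -> : (a + q) * (a - q) = (a * a + b * p) - (p * b + q * q) by ring.
    by rewrite e11 e22 subrr.
  by move=> /eqP; rewrite mulf_eq0 (negPf t0) /= subr_eq0 => /eqP.
exists a; first by apply: contraTneq D => ->; rewrite b0 !mul0r subrr ltxx.
by apply: mx2P; rewrite !mxE /= ?mulr1n ?mulr0n.
Qed.

End Conformal.

Section Group.
Variables (R : realType) (G : set (S2 R -> S2 R)).
Hypotheses (Ggrp : is_group G) (GD : G `<=` @Diff1plus R) (RotG : @Rot R `<=` G)
  (G3 : sharply_three_transitive G).
Implicit Types (f g : S2 R -> S2 R) (u w : 'rV[R]_2) (c s : R).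

Let GM f g : G f -> G g -> G (f \o g). Proof. by case: Ggrp => _ [+ _]; exact. Qed.
Let GV f : G f -> exists2 g, G g & cancel f g /\ cancel g f.
Proof. by case: Ggrp => _ [_]; exact. Qed.

(** Sharpness applied to the composite of [f] with the inverse of [g]. *)
Lemma sharp_eq f g (p1 p2 p3 : S2 R) : G f -> G g -> [/\ p1 <> p2, p1 <> p3 & p2 <> p3] ->
  f p1 = g p1 -> f p2 = g p2 -> f p3 = g p3 -> f = g.
Proof.
move=> Gf Gg pd e1 e2 e3; have [h Gh [gh hg]] := GV Gg.
have hf : h \o f = id.
  by apply: (G3.2 _ (GM Gh Gf) p1 p2 p3) => //=; rewrite e1 e2 e3 !gh.
by apply/funext => p; rewrite -[f p]hg -[h (f p)]/((h \o f) p) hf.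
Qed.

Lemma G_inj f : G f -> injective f.
Proof. by move=> /GV[g _ [fg _]]; exact: can_inj fg. Qed.

Lemma north_neq_south : north R <> south R.
Proof. by rewrite south_chart => e; exact: (@chart_inv_neq_north R 0). Qed.

(* Membership in the subgroup [H] of the header: south is [0] and north is [oo]. *)
Definition axial f := [/\ G f, f (north R) = north R & f (south R) = south R].

Lemma axial_neq_north f u : axial f -> f (chart_inv true u) <> north R.
Proof.
by move=> [Gf fn _]; rewrite -fn => /(G_inj Gf); exact: chart_inv_neq_north.
Qed.

Lemma axial_chart f u : axial f -> f (chart_inv true u) = chart_inv true (plane_map f u).
Proof. by move=> af; rewrite plane_mapK //; exact: axial_neq_north. Qed.

Lemma axial0 f : axial f -> plane_map f 0 = 0.
Proof. by move=> [_ _ fs]; apply: plane_map_eq; rewrite -south_chart. Qed.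

Lemma axial_neq0 f u : axial f -> u != 0 -> plane_map f u != 0.
Proof.
move=> af; apply: contra_neq => fu; have [Gf _ fs] := af.
have := axial_chart u af; rewrite fu -south_chart -fs south_chart => /(G_inj Gf).
by move=> /(can_inj (@chart_invK R)).
Qed.

Lemma axial_diff f u : axial f -> is_diff u (plane_map f) (mulmxr (dmx (plane_map f) u)).
Proof.
by move=> af; apply: plane_map_diff; [case: af => /GD | exact: axial_neq_north].
Qed.

(** * Elements fixing both poles commute with rotations about the axis *)

Definition zrot c s : S2 R -> S2 R := mob_map (c +i* s) 0 0 1.

Lemma zrot_G c s : c ^+ 2 + s ^+ 2 = 1 -> G (zrot c s).
Proof. by move=> cs; apply: RotG; exact: zrot_Rot. Qed.

Lemma zrot_axial c s : c ^+ 2 + s ^+ 2 = 1 -> axial (zrot c s).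
Proof.
move=> cs; split; [exact: zrot_G | exact: dilate_north |].
by rewrite /zrot south_chart dilate_chart mul0mx.
Qed.

Lemma plane_map_zrot c s : plane_map (zrot c s) = mulmxr (rot2 c s).
Proof. exact: plane_map_dilate. Qed.

(** General [a] and [b] serve both the circles in the source and their images under maps commuting
    with rotations. *)
Lemma circ_diff (a b : 'rV[R]_2) (t : R) :
  is_diff t (fun x : R => cos x *: a + sin x *: b)
    (fun h => h *: (- sin t *: a + cos t *: b)).
Proof.
have Zl (k : R -> R) (dk : R) (v : 'rV[R]_2) : is_derive t 1 k dk ->
    is_diff t (fun x => k x *: v) (fun h => h *: (dk *: v)).
  move=> [k1 k2]; have dk' : differentiable k t by exact/derivable1_diffP.
  split; first exact: differentiableZl.
  rewrite (diffZl v dk'); apply/funext => h.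
  by rewrite deriv1E // derive1E k2 /= -scalerA.
apply: is_diff_eq (is_diffD (Zl _ _ a _) (Zl _ _ b _)) _.
by apply/funext => h; rewrite scalerDr.
Qed.

(** [periodic_chord] is applied to the squared modulus of [f] along the unit circle, with period
    [2 pi]. *)
Lemma equal_modulus_chord f c s : axial f -> c ^+ 2 + s ^+ 2 = 1 ->
  exists u, u != 0 /\ let v := plane_map f u in let w := plane_map f (u *m rot2 c s) in
   v ord0 j1 ^+ 2 + v ord0 j2 ^+ 2 = w ord0 j1 ^+ 2 + w ord0 j2 ^+ 2.
Proof.
move=> af /unit_angle[d [d0 d2 <- <-]].
pose k t := (plane_map f (circ t)) ord0 j1 ^+ 2 + (plane_map f (circ t)) ord0 j2 ^+ 2.
have cP : continuous (fun t => plane_map f (circ t)).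
  move=> t; apply: differentiable_continuous.
  apply: (@differentiable_comp _ _ _ _ (@circ R) (plane_map f)).
    by have [] := circ_diff (e2 R j1) (e2 R j2) t.
  by have [] := axial_diff (circ t) af.
have cPj j : continuous (fun t => (plane_map f (circ t)) ord0 j).
  move=> t; apply: (@continuous_comp _ _ _ (fun t => plane_map f (circ t))
    (fun v : 'rV[R]_2 => v ord0 j)); [exact: cP | exact: coord_continuous].
have ck : continuous k.
  by move=> t; apply: cvgD; apply: cvgM; exact: cPj.
have [x|t kt] := @periodic_chord R k (pi *+ 2) d ck _ d0 d2.
  by rewrite /k !circE cosD2pi sinD2pi.
by exists (circ t); split; [exact: circ_neq0 | rewrite /= -circD -/(k t) -/(k (t + d)) kt].
Qed.

(** The images of [u] and of the rotated [u] have equal modulus, so a rotation carries one to the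
    other. The two composites then agree at both poles and at [u], and sharpness makes them
    equal. *)
Lemma axial_conj_zrot f c s : axial f -> c ^+ 2 + s ^+ 2 = 1 ->
  exists c' s', c' ^+ 2 + s' ^+ 2 = 1 /\ f \o zrot c s = zrot c' s' \o f.
Proof.
move=> af cs; have [u [u0 uw]] := equal_modulus_chord af cs.
have [c' [s' [cs' E]]] := rot2_transitive (axial_neq0 af u0) uw.
exists c', s'; split=> //; have [Gf fn fs] := af.
have [Gz zn zs] := zrot_axial cs; have [Gz' zn' zs'] := zrot_axial cs'.
apply: (@sharp_eq _ _ (north R) (south R) (chart_inv true u)) => /=.
- exact: GM.
- exact: GM.
- split; first exact: north_neq_south.
    by move=> e; exact: (chart_inv_neq_north (esym e)).
  by rewrite south_chart => /(can_inj (@chart_invK R)) e; move: u0; rewrite -e eqxx.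
- by rewrite zn fn zn'.
- by rewrite zs fs zs'.
- by rewrite /zrot dilate_chart !(axial_chart _ af) dilate_chart E.
Qed.

(** Differentiating the conjugation relation at 0 and applying [rot2_conj] shows that the two
    rotations coincide. *)
Lemma axial_commute f c s : axial f -> c ^+ 2 + s ^+ 2 = 1 ->
  f \o zrot c s = zrot c s \o f /\
  rot2 c s *m dmx (plane_map f) 0 = dmx (plane_map f) 0 *m rot2 c s.
Proof.
move=> af cs; have [c' [s' [cs' E]]] := axial_conj_zrot af cs.
have [Gf fn fs] := af; have az := zrot_axial cs; have az' := zrot_axial cs'.
have Df := GD Gf; have Dz := GD (zrot_G cs); have Dz' := GD (zrot_G cs').
have Ed : rot2 c s *m dmx (plane_map f) 0 = dmx (plane_map f) 0 *m rot2 c' s'.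
  have := congr1 (fun h => dmx (plane_map h) 0) E; cbv beta.
  have nf u : f (chart_inv true u) <> north R by exact: axial_neq_north.
  have nz u : zrot c s (chart_inv true u) <> north R by exact: axial_neq_north.
  have nz' u : zrot c' s' (chart_inv true u) <> north R by exact: axial_neq_north.
  have nfz : f (zrot c s (chart_inv true 0)) <> north R by rewrite (axial_chart _ az).
  have nzf : zrot c' s' (f (chart_inv true 0)) <> north R by rewrite (axial_chart _ af).
  rewrite (dmx_chain Df Dz (nz 0) nfz) (dmx_chain Dz' Df (nf 0) nzf).
  by rewrite (axial0 az) (axial0 af) !plane_map_zrot !dmx_mulmxr.
have [] := rot2_conj _ cs cs' Ed; last by move=> ec es; move: E Ed; rewrite ec es.
by apply: det_plane_map => //; exact: axial_neq_north.
Qed.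

(** * Conformality at the origin and on the positive axis *)

Lemma axial_conformal0 f : axial f -> conformal (dmx (plane_map f) 0).
Proof.
by move=> af; have [] := @axial_commute f 0 1 af _; rewrite ?expr0n ?expr1n ?add0r.
Qed.

(** If [north] is moved, an involution [j] in [G] brings it back, and [axial_conformal0] applies to
    [j \o f]. *)
Lemma fix_south_conformal f : G f -> f (south R) = south R -> conformal (dmx (plane_map f) 0).
Proof.
move=> Gf fs; have [fn|fn] := pselect (f (north R) = north R).
  by apply: axial_conformal0; split.
have fN : f (north R) <> south R.
  by rewrite -fs => /(G_inj Gf); exact: north_neq_south.
have NS := north_neq_south.
have [j Gj [js jn jf]] : exists2 j, G j & [/\ j (south R) = south R,
    j (north R) = f (north R) & j (f (north R)) = north R].
  by apply: G3.1; split; do ?[by []|exact: nesym].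
have jj : j \o j = id.
  apply: (G3.2 _ (GM Gj Gj) (south R) (north R) (f (north R))) => /=.
    by split; do ?[by []|exact: nesym].
  by rewrite js jn jf.
have south_dom g : g (south R) = south R -> g (chart_inv true 0) <> north R.
  by rewrite south_chart => ->; exact: chart_inv_neq_north.
have plane0 g : g (south R) = south R -> plane_map g 0 = 0.
  by rewrite south_chart => gs; exact: plane_map_eq.
have Dj := GD Gj; have Df := GD Gf.
(* The differential of [j] at 0 squares to the identity and has positive determinant, so it is a
   nonzero scalar and can be cancelled. *)
have [k k0 jk] : exists2 k : R, k != 0 & dmx (plane_map j) 0 = k%:M.
  apply: sqr_id_scalar; first by apply: det_plane_map => //; exact: south_dom.
  have : dmx (plane_map (j \o j)) 0 = 1%:M.
    have -> : plane_map (j \o j) = mulmxr 1%:M; last exact: dmx_mulmxr.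
    by rewrite jj; apply/funext => u; apply: plane_map_eq; rewrite /= mulmx1.
  have njj : j (j (chart_inv true 0)) <> north R.
    by rewrite -south_chart js js; exact: nesym.
  by rewrite (dmx_chain Dj Dj (south_dom j js) njj) (plane0 j js).
have ajf : axial (j \o f) by split; [exact: GM | rewrite /= jf | rewrite /= fs].
have := axial_conformal0 ajf; rewrite dmx_chain //; last 2 first.
- exact: south_dom.
- by rewrite -south_chart fs js; exact: nesym.
rewrite plane0 // jk scalar_mxC; exact: conformal_scale.
Qed.

Lemma yrot_G c s : c ^+ 2 + s ^+ 2 = 1 -> G (yrot c s).
Proof. by move=> cs; apply: RotG; exact: yrot_Rot. Qed.

Lemma yrot_to (r : R) : exists c s, [/\ c != 0, c ^+ 2 + s ^+ 2 = 1 &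
  yrot c s (chart_inv true 0) = chart_inv true (vec2 r 0)].
Proof.
pose n := Num.sqrt (1 + r ^+ 2).
have n0 : 0 < n by rewrite sqrtr_gt0 ltr_pwDl // sqr_ge0.
have n2 : n ^+ 2 = 1 + r ^+ 2 by rewrite sqr_sqrtr // addr_ge0 // sqr_ge0.
have n0' := lt0r_neq0 n0.
(* The normalized solution of [- s / c = r]. *)
exists n^-1, (- r / n); split; first by rewrite invr_eq0.
  have -> : n^-1 ^+ 2 + (- r / n) ^+ 2 = (1 + r ^+ 2) / n ^+ 2 by field.
  by rewrite n2 divff // -n2 expf_neq0.
rewrite yrot_origin ?invr_eq0 //; congr (chart_inv true (vec2 _ 0)).
by field.
Qed.

(** Rotations [A] and [B] carry 0 to the point on the axis and to its image, so the inverse of [B]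
    after [f \o A] fixes 0 and is conformal there. The differentials of [A] and [B] at 0 are a
    scalar and a scalar times a rotation. *)
Lemma axial_conformal f (r : R) : axial f -> 0 < r ->
  conformal (dmx (plane_map f) (vec2 r 0)).
Proof.
move=> af r0; have [Gf _ _] := af; set w := plane_map f (vec2 r 0).
have w0 : w != 0.
  apply: axial_neq0 => //; apply/eqP => /(congr1 (fun v : 'rV[R]_2 => v ord0 j1)).
  by rewrite vec2E mxE => e; move: r0; rewrite e ltxx.
pose q := Num.sqrt (w ord0 j1 ^+ 2 + w ord0 j2 ^+ 2).
have q2 : q ^+ 2 = w ord0 j1 ^+ 2 + w ord0 j2 ^+ 2.
  by rewrite sqr_sqrtr // ltW // rV2_neq0.
have q0 : 0 < q by rewrite sqrtr_gt0 rV2_neq0.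
have [||c [s [cs qw]]] := @rot2_transitive R (vec2 q 0) w.
- by apply/eqP => /(congr1 (fun v : 'rV[R]_2 => v ord0 j1)); rewrite vec2E mxE => e;
    move: q0; rewrite e ltxx.
- by rewrite -q2 !(vec2E q) expr0n /= addr0.
have [ca [sa [ca0 csa Ya]]] := yrot_to r.
have [cb [sb [cb0 csb Yb]]] := yrot_to q.
have GA := yrot_G csa; have GB := GM (zrot_G cs) (yrot_G csb).
set A := yrot ca sa in Ya GA; set B := zrot c s \o yrot cb sb in GB.
have B0 : B (chart_inv true 0) = chart_inv true w by rewrite /B /= Yb /zrot dilate_chart qw.
have [B' GB' [BK KB]] := GV GB.
pose g := B' \o (f \o A).
have Gg : G g by apply: GM => //; exact: GM.
have gs : g (south R) = south R.
  by rewrite south_chart /g /= Ya axial_chart // -/w -B0 BK.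
have cg := fix_south_conformal Gg gs.
(* The chain rule is applied to this form, so the differential of the inverse [B'] is never
   computed. *)
have E : f \o A = B \o g by apply/funext => p; rewrite /g /= KB.
have DY := GD (yrot_G csb); have Dz := GD (zrot_G cs).
have nA : A (chart_inv true 0) <> north R by rewrite Ya; exact: chart_inv_neq_north.
have nfA : f (A (chart_inv true 0)) <> north R by rewrite Ya; exact: axial_neq_north.
have ng : g (chart_inv true 0) <> north R.
  by rewrite -south_chart gs; exact: nesym north_neq_south.
have nBg : B (g (chart_inv true 0)) <> north R.
  by rewrite -south_chart gs south_chart B0; exact: chart_inv_neq_north.
have nY : yrot cb sb (chart_inv true 0) <> north R.
  by rewrite Yb; exact: chart_inv_neq_north.
have nzY : zrot c s (yrot cb sb (chart_inv true 0)) <> north R.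
  by rewrite Yb; exact: (axial_neq_north (zrot_axial cs)).
have g0 : plane_map g 0 = 0 by apply: plane_map_eq; rewrite -south_chart.
have A0 : plane_map A 0 = vec2 r 0 by exact: plane_map_eq.
have := congr1 (fun h => dmx (plane_map h) 0) E; cbv beta.
rewrite (dmx_chain (GD Gf) (GD GA) nA nfA) (dmx_chain (GD GB) (GD Gg) ng nBg) g0 A0.
rewrite (dmx_chain Dz DY nY nzY) plane_map_zrot dmx_mulmxr.
rewrite (dmx_yrot ca0 csa (GD GA)) (dmx_yrot cb0 csb DY).
move=> {}E; apply: (@conformal_scale _ (ca ^- 2)); first by rewrite invr_eq0 expf_neq0.
by rewrite E; apply: conformalM => //; apply: conformalM;
  [exact: conformal_scalar | exact: conformal_rot2].
Qed.

(** * Elements fixing both poles are complex dilations *)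

Lemma axial_rotate f c s u : axial f -> c ^+ 2 + s ^+ 2 = 1 ->
  plane_map f (u *m rot2 c s) = plane_map f u *m rot2 c s.
Proof.
move=> af cs; apply: plane_map_eq; rewrite -dilate_chart -/(zrot c s).
have [E _] := axial_commute af cs.
rewrite -[f _]/((f \o zrot c s) _) E /= (axial_chart _ af) /zrot.
by rewrite dilate_chart.
Qed.

Lemma mul_rot2_01 (v : 'rV[R]_2) : v *m rot2 0 1 = vec2 (- v ord0 j2) (v ord0 j1).
Proof. by rewrite mul_rot2E; apply: vec2P; rewrite !vec2E; ring. Qed.

Lemma rot2_decomp (v : 'rV[R]_2) c s : v *m rot2 c s = c *: v + s *: (v *m rot2 0 1).
Proof. by rewrite mul_rot2_01 mul_rot2E; apply: vec2P; rewrite !vec2E !mxE /=; ring. Qed.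

Lemma coordZ (a : R) (v : 'rV[R]_2) j : (a *: v) ord0 j = a * v ord0 j.
Proof. by rewrite mxE. Qed.

(* In polar coordinates the Cauchy-Riemann equation reads [r f_r = - i f_theta],
   and [f_theta = i f] because [f] commutes with rotations. *)
Lemma axial_radial_derivative f (r : R) : axial f -> 0 < r ->
  r *: 'D_(e2 R j1) (plane_map f) (vec2 r 0) = plane_map f (vec2 r 0).
Proof.
move=> af r0; set w := plane_map f (vec2 r 0); set A := dmx (plane_map f) (vec2 r 0).
have cA : conformal A by exact: axial_conformal.
have re1 : r *: e2 R j1 = vec2 r 0 by apply: vec2P; rewrite !mxE /= ?mulr1 ?mulr0.
(* The derivative at [x = 0] of [f(r e^(ix)) = e^(ix) f(r)]. *)
have ang : r *: row j2 A = w *m rot2 0 1.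
  pose gam (x : R) := cos x *: (r *: e2 R j1) + sin x *: (r *: e2 R j2).
  have gam0 : gam 0 = vec2 r 0 by rewrite /gam cos0 sin0 scale1r scale0r addr0.
  have dgam := circ_diff (r *: e2 R j1) (r *: e2 R j2) 0.
  have df := axial_diff (vec2 r 0) af; rewrite -/A -gam0 in df.
  have d1 := is_diff_comp dgam df.
  have d2 := circ_diff w (w *m rot2 0 1) 0.
  have E : plane_map f \o gam = (fun x : R => cos x *: w + sin x *: (w *m rot2 0 1)).
    apply/funext => x; rewrite /comp.
    have -> : gam x = vec2 r 0 *m rot2 (cos x) (sin x).
      by rewrite mul_rot2E; apply: vec2P; rewrite !vec2E !mxE /=; ring.
    by rewrite axial_rotate ?cos2Dsin2 // -/w rot2_decomp.
  have e1 := @diff_val _ _ _ _ _ _ _ d1.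
  have e2 := @diff_val _ _ _ _ _ _ _ d2.
  have E' := congr1 (fun h => 'd h 0 : _ -> _) E.
  have := congr1 (fun k => k 1) (etrans (esym e1) (etrans E' e2)).
  rewrite /= sin0 cos0 !oppr0 !scale0r !add0r !scale1r => <-.
  by rewrite -scalemxAl -rowE.
(* The first row of the conformality relation expresses [row j2 A] as [row j1 A] turned by a
   quarter; a second quarter turn then removes the rotation up to sign. *)
have /(congr1 (row j1)) := cA; rewrite !row_mul -/A.
have -> : row j1 (rot2 0 1) = e2 R j2 by apply: vec2P; rewrite !mxE.
move=> rA; move: ang; rewrite rowE rA.
move=> /(congr1 (fun v => v *m rot2 0 1)).
rewrite -scalemxAl -!mulmxA => E.
have J2 : rot2 0 1 *m rot2 0 1 = - 1%:M :> 'M[R]_2.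
  by apply: mx2P; rewrite mulmx2E !rot2E !mxE /= ?mulr1n ?mulr0n; ring.
by move: E; rewrite J2 !mulmxN !mulmx1 scalerN row_dmx => /oppr_inj.
Qed.

(** Each coordinate satisfies [x phi'(x) = phi(x)], so [phi(x) / x] has derivative 0 on the positive
    axis and equals its value at 1. *)
Lemma axial_radial f (r : R) : axial f -> 0 < r ->
  plane_map f (vec2 r 0) = r *: plane_map f (vec2 1 0).
Proof.
move=> af r0; apply/rowP => j; rewrite coordZ.
(* The summand 0 gives [phi] the shape expected by [derive_line]. *)
pose k u := plane_map f u ord0 j; pose phi (x : R) := k (0 + x *: e2 R j1).
have e1E (x : R) : 0 + x *: e2 R j1 = vec2 x 0.
  by rewrite add0r; apply: vec2P; rewrite !mxE /= ?mulr1 ?mulr0.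
have phiE x : phi x = plane_map f (vec2 x 0) ord0 j by rewrite /phi e1E.
have dphi (x : R) : 0 < x -> is_derive x 1 phi (phi x / x).
  move=> x0; have [dd _] := axial_diff (vec2 x 0) af.
  have dg : derivable (plane_map f) (vec2 x 0) (e2 R j1) by exact: diff_derivable.
  have dk : derivable k (0 + x *: e2 R j1) (e2 R j1).
    by rewrite e1E; move: dg => /derivable_mxP; exact.
  have -> : phi x / x = 'D_(e2 R j1) k (0 + x *: e2 R j1); last exact: derive_line.
  have := congr1 (fun v : 'rV[R]_2 => v ord0 j) (axial_radial_derivative af x0).
  have Dk : 'D_(e2 R j1) k (vec2 x 0) = 'D_(e2 R j1) (plane_map f) (vec2 x 0) ord0 j.
    by rewrite (derive_mx dg) mxE.
  by rewrite coordZ e1E Dk phiE => <-; rewrite mulrC mulKf // gt_eqF.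
pose psi (x : R) := phi x * x^-1.
have dpsi (x : R) : 0 < x -> is_derive x 1 psi 0.
  move=> x0; have xn : x != 0 by rewrite gt_eqF.
  have dV : is_derive x 1 (fun y : R => y^-1) (- x ^- 2 *: 1).
    exact: (@is_deriveV _ id).
  apply: is_derive_eq (is_deriveM (dphi x x0) dV) _.
  by rewrite /GRing.scale /=; field.
have psi_eq (a b : R) : 0 < a -> a < b -> psi b = psi a.
  move=> a0 ab; have pos (x : R) : x \in `[a, b]%R -> 0 < x.
    by rewrite in_itv /= => /andP[ax _]; exact: lt_le_trans ax.
  have [||c _ /eqP] := @MVT R psi (fun=> 0) a b ab.
  - by move=> x /subset_itv_oo_cc/pos/dpsi.
  - apply: continuous_in_subspaceT => x /set_mem/= /pos/dpsi d.
    apply: differentiable_continuous; apply/derivable1_diffP; exact: ex_derive.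
  by rewrite mul0r subr_eq0 => /eqP.
have : psi r = psi 1.
  by case: (ltgtP r 1) => [r1|r1|->//]; [rewrite -(psi_eq r 1) | rewrite (psi_eq 1 r)].
rewrite /psi invr1 mulr1 !phiE => <-.
by rewrite mulrC mulfVK // gt_eqF.
Qed.

(** The factor is [f(1)]: in polar form [u = r e^(it)], equivariance extracts [e^(it)] and
    [axial_radial] extracts [r]. *)
Lemma axial_dilate f : axial f -> exists2 z : R[i], z != 0 & f = mob_map z 0 0 1.
Proof.
move=> af; have [_ fn fs] := af; pose w := plane_map f (vec2 1 0).
have w0 : w != 0.
  apply: axial_neq0 => //; apply/eqP => /(congr1 (fun v : 'rV[R]_2 => v ord0 j1)).
  by rewrite vec2E mxE => /eqP; rewrite oner_eq0.
exists (w ord0 j1 +i* w ord0 j2).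
  apply: contra w0; rewrite eq_complex /= => /andP[/eqP e1 /eqP e2].
  by rewrite (vec2_eta w) e1 e2 vec2_0.
apply/funext => p; have [->|pn] := pselect (p = north R); first by rewrite dilate_north.
rewrite -(chartK pn); move: (chart true p) => u {pn}.
rewrite dilate_chart (axial_chart _ af); congr (chart_inv true _).
have [->|u0] := eqVneq u 0; first by rewrite mul0mx axial0.
pose r := Num.sqrt (u ord0 j1 ^+ 2 + u ord0 j2 ^+ 2).
have r0 : 0 < r by rewrite sqrtr_gt0 rV2_neq0.
have r2 : r ^+ 2 = u ord0 j1 ^+ 2 + u ord0 j2 ^+ 2.
  by rewrite sqr_sqrtr // ltW // rV2_neq0.
have rn : r != 0 by rewrite gt_eqF.
have cs : (u ord0 j1 / r) ^+ 2 + (u ord0 j2 / r) ^+ 2 = 1.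
  by rewrite !expr_div_n -mulrDl -r2 divff // expf_neq0.
have E : u = vec2 r 0 *m rot2 (u ord0 j1 / r) (u ord0 j2 / r).
  by rewrite mul_rot2E; apply: vec2P; rewrite !vec2E; field.
rewrite {1}E axial_rotate // axial_radial // -/w; clearbody w.
by rewrite !mul_rot2E; apply: vec2P; rewrite !vec2E !coordZ; field.
Qed.

(** * Generation of the Moebius group *)

(** Transitivity provides an element of [G] that fixes both poles and sends 1 to [z]; [axial_dilate]
    identifies it. *)
Lemma dilate_G (z : R[i]) : z != 0 -> G (mob_map z 0 0 1).
Proof.
move=> z0; pose P (v : R[i]) := stereoC_inv v.
have P0 : P 0 = south R by rewrite south_chart chart_inv_stereo !mxE.
have Pinj a b : P a = P b -> a = b by exact: (can_inj (@stereoC_invK R)).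
have Pn a : north R <> P a by move=> e; exact: (stereoC_inv_neq_north (esym e)).
have [f Gf [fn fs f1]] : exists2 f, G f & [/\ f (north R) = north R,
    f (P 0) = P 0 & f (P 1) = P z].
  apply: G3.1; split=> //; first by move=> /Pinj /eqP; rewrite eq_sym oner_eq0.
  by move=> /Pinj /eqP; rewrite eq_sym (negPf z0).
have af : axial f by split=> //; rewrite -P0.
have [y y0 E] := axial_dilate af.
suff <- : y = z by rewrite -E.
by apply: Pinj; rewrite -f1 E /P mob_stereo ?mul0r ?add0r ?oner_eq0 // mulr1 addr0 divr1.
Qed.

(** Rescaling frees the real coefficients from [a^2 + b^2 = 1], so that integers may be used. *)
Lemma yrot_mob_G (a b : R) : a ^+ 2 + b ^+ 2 != 0 ->
  G (mob_map a%:C (- b)%:C b%:C a%:C).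
Proof.
move=> n0; pose n := Num.sqrt (a ^+ 2 + b ^+ 2).
have n2 : n ^+ 2 = a ^+ 2 + b ^+ 2 by rewrite sqr_sqrtr // addr_ge0 ?sqr_ge0.
have nn : n != 0 by apply: contraNneq n0 => e; rewrite -n2 e expr0n.
have cs : (a / n) ^+ 2 + (b / n) ^+ 2 = 1.
  by rewrite !expr_div_n -mulrDl -n2 divff // expf_neq0.
have nC : n%:C != 0 by apply: contra nn; rewrite eq_complex /= => /andP[].
have := yrot_G cs; rewrite /yrot -(@mobZ _ n%:C) //.
  have -> : n%:C * (a / n)%:C = a%:C by rewrite -rmorphM mulrC divfK.
  have -> : n%:C * (b / n)%:C = b%:C by rewrite -rmorphM mulrC divfK.
  by have -> : n%:C * (- (b / n))%:C = (- b)%:C by rewrite -rmorphM mulrN mulrC divfK.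
have -> : (a / n)%:C * (a / n)%:C - (- (b / n))%:C * (b / n)%:C = 1.
  by rewrite -!rmorphM -rmorphB mulNr opprK -!expr2 cs.
exact: oner_neq0.
Qed.

Lemma natC_neq0 (n : nat) : (n.+1%:R : R[i]) != 0.
Proof. by rewrite pnatr_eq0. Qed.

(* [(2z + 1)/(2 - z)], [2z] and [(z - 1)/(z + 1)] compose to [(5z - 3)/4]. *)
Lemma affine_base_G : G (mob_map 5 (- 3) 0 4).
Proof.
have A : G (mob_map 1 (- 1) 1 1).
  have := @yrot_mob_G 1 1; rewrite !rmorphN rmorph1; apply.
  by rewrite !expr1n gt_eqF // addr_gt0.
have B : G (mob_map 2 1 (- 1) 2).
  have := @yrot_mob_G 2 (- 1); rewrite !rmorphN opprK rmorph1 rmorph_nat; apply.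
  by rewrite gt_eqF // ltr_pwDl ?exprn_gt0 // sqr_ge0.
have D := dilate_G (natC_neq0 1).
have := GM B (GM D A); rewrite mob_comp; last 2 first.
- by rewrite mulr1 mul0r subr0 natC_neq0.
- by rewrite !mul1r mulN1r opprK (natC_neq0 1).
rewrite mob_comp; last 2 first.
- by rewrite (_ : _ - _ = 5) ?natC_neq0 //; ring.
- by rewrite (_ : _ - _ = 4) ?natC_neq0 //; ring.
by congr (G (mob_map _ _ _ _)); ring.
Qed.

Lemma affine_G (a b : R[i]) : a != 0 -> G (mob_map a b 0 1).
Proof.
move=> a0; have [->|b0] := eqVneq b 0; first exact: dilate_G.
have n3 := natC_neq0 2; have n4 := natC_neq0 3; have n5 := natC_neq0 4.
(* Solves [al (5 be z - 3) / 4 = a z + b]; [b = 0] is set apart because [al] must be nonzero. *)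
pose al := - (4 * b / 3); pose be := 4 * a / (5 * al).
have al0 : al != 0 by rewrite oppr_eq0 !mulf_neq0 ?invr_eq0.
have be0 : be != 0 by rewrite !mulf_neq0 ?invr_eq0 ?mulf_neq0.
have := GM (dilate_G al0) (GM affine_base_G (dilate_G be0)).
rewrite mob_comp; last 2 first.
- by rewrite mulr0 subr0 mulf_neq0.
- by rewrite mulr1 mulr0 subr0.
rewrite mob_comp; last 2 first.
- by rewrite mulr1 mulr0 subr0.
- by rewrite (_ : _ - _ = 5 * be * 4); [exact: mulf_neq0 (mulf_neq0 n5 be0) n4 | ring].
rewrite -[mob_map a b 0 1](@mobZ _ 4) //; last by rewrite mulr1 mulr0 subr0.
congr (G (mob_map _ _ _ _)).
- by rewrite /be; field; rewrite al0.
- by rewrite /al; field.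
- by ring.
- by ring.
Qed.

(** For [c] nonzero, [(az + b) / (cz + d) = a/c - ((ad - bc) / c) / (cz + d)] is affine after
    [z |-> -1/z] after affine. For [c = 0] the map is affine. *)
Lemma mob_G (a b c d : R[i]) : a * d - b * c != 0 -> G (mob_map a b c d).
Proof.
have [->|c0] := eqVneq c 0.
  rewrite mulr0 subr0 mulf_eq0 negb_or => /andP[a0 d0].
  have := @affine_G (a / d) (b / d) _; rewrite -(@mobZ _ d) //; last first.
    by rewrite mulr1 mulr0 subr0 mulf_neq0 ?invr_eq0.
  by rewrite mulr0 mulr1 !(mulrC d) !divfK //; apply; rewrite mulf_neq0 ?invr_eq0.
move=> D.
have I : G (mob_map 0 (- 1) 1 0).
  have := @yrot_mob_G 0 1; rewrite rmorphN rmorph1 rmorph0; apply.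
  by rewrite expr0n add0r expr1n oner_eq0.
have := GM (@affine_G ((a * d - b * c) / c) (a / c) _) (GM I (@affine_G c d c0)).
rewrite mob_comp; last 2 first.
- by rewrite mulr1 mul0r sub0r opprK oner_eq0.
- by rewrite mulr1 mulr0 subr0.
rewrite mob_comp; last 2 first.
- by rewrite mulr1 mulr0 subr0 mulf_neq0 ?invr_eq0.
- by rewrite (_ : _ - _ = c) //; ring.
rewrite (_ : mob_map _ _ _ _ = mob_map a b c d); first by apply; rewrite mulf_neq0 ?invr_eq0.
by congr mob_map; field.
Qed.

(** Proportional coordinates give the same point; conversely, the coordinates of two distinct points
    form an invertible matrix. *)
Lemma hpt_eq (z w z' w' : R[i]) : (z != 0) || (w != 0) -> (z' != 0) || (w' != 0) ->
  z * w' - z' * w = 0 -> hpt z w = hpt z' w'.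
Proof.
move=> zw zw' /eqP; rewrite subr_eq0 => /eqP E; rewrite /hpt.
case: (eqVneq w 0) zw E => [->|w0]; case: (eqVneq w' 0) zw' => [->|w'0] //=.
- by move=> _; rewrite orbF mulr0 => z0 /eqP; rewrite mulf_eq0 (negPf z0) (negPf w'0).
- rewrite orbF mulr0 => z'0 _ /esym/eqP.
  by rewrite mulf_eq0 (negPf z'0) (negPf w0).
- by move=> _ _ E; congr stereoC_inv; apply/eqP; rewrite eqr_div // E.
Qed.

Lemma G_eq_Mob : G = @Mob R.
Proof.
apply/seteqP; split=> [g Gg|_ [a [b [c [d [D ->]]]]]]; last first.
  by apply: mob_G; rewrite D oner_eq0.
have [z [w [zw gn]]] := hpt_surj (g (north R)).
have [z' [w' [zw' gs]]] := hpt_surj (g (south R)).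
(* The matrix with columns [(z, w)] and [(z', w')] sends [north = [1 : 0]] and [south = [0 : 1]] to
   their images under [g], so its inverse after [g] fixes both poles. *)
have D : z * w' - z' * w != 0.
  apply/eqP => /(hpt_eq zw zw'); rewrite -gn -gs => /(G_inj Gg).
  exact: north_neq_south.
have nE : north R = hpt 1 0 by rewrite /hpt eqxx.
have sE : south R = hpt 0 1.
  by rewrite /hpt oner_eq0 divr1 south_chart chart_inv_stereo !mxE.
have Gm := mob_G D; have [m' Gm' [mK Km]] := GV Gm.
have am : axial (m' \o g).
  split; first exact: GM.
  - rewrite /= gn -[RHS]mK; congr m'.
    by rewrite nE mob_hpt ?oner_eq0 // !mulr1 !mulr0 !addr0.
  - rewrite /= gs -[RHS]mK; congr m'.
    by rewrite sE mob_hpt ?oner_eq0 ?orbT // !mulr1 !mulr0 !add0r.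
have [y y0 E] := axial_dilate am.
have -> : g = mob_map z z' w w' \o mob_map y 0 0 1.
  by rewrite -E; apply/funext => p /=; rewrite Km.
rewrite mob_comp //; last by rewrite mulr1 mulr0 subr0.
apply: mob_Mob; rewrite (_ : _ - _ = y * (z * w' - z' * w)); last by ring.
by rewrite mulf_neq0.
Qed.

End Group.

Theorem theoremC (R : realType) (G : set (S2 R -> S2 R)) :
  is_group G -> G `<=` @Diff1plus R -> @Rot R `<=` G ->
  sharply_three_transitive G -> G = @Mob R.
Proof. exact: G_eq_Mob. Qed.
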